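(* Let $\mathcal A$ be an abelian category. Each of the categories of chain complexes $C(\mathcal A)$, $C^+(\mathcal A)$, $C^-(\mathcal A)$, $C^b(\mathcal A)$, with quasi-isomorphisms as weak equivalences, monics as cofibrations and epics as fibrations, is a pointed ABC premodel category with all objects both fibrant and cofibrant.
   Context: $C(\mathcal A)$ is the category of $\mathbb Z$-graded chain complexes in $\mathcal A$; $C^+(\mathcal A)$, $C^-(\mathcal A)$, $C^b(\mathcal A)$ are its full subcategories of bounded below, bounded above, bounded complexes. All are abelian with degreewise kernels and cokernels. A quasi-isomorphism is a map of complexes inducing isomorphisms on all homology objects. Pointed means having a zero object. A precofibration category $(\mathcal M,\mathcal W,\mathrm{Cof})$ is a category $\mathcal M$ with two classes of maps, weak equivalences $\mathcal W$ and cofibrations $\mathrm{Cof}$ (a trivial cofibration is a map in both; $A$ is cofibrant if $\mathbf 0\to A$ is a cofibration, $\mathbf 0$ the initial object), such that: CF1: $\mathcal M$ has an initial object $\mathbf 0$, which is cofibrant; cofibrations are stable under composition; all isomorphisms are weak equivalences, and all isomorphisms with cofibrant domain are trivial cofibrations. CF2: if $gf$ is defined and two of $f,g,gf$ are weak equivalences, so is the third. CF3: for a cofibration $i:A\to B$ and a map $A\to C$ with $A,C$ cofibrant, (1) the pushout of $i$ along $A\to C$ exists and $C\to B\sqcup_A C$ is a cofibration; (2) if $i$ is a trivial cofibration, so is $C\to B\sqcup_A C$. CF4: any map $f:A\to B$ with $A$ cofibrant factors as $f=rf'$ with $f'$ a cofibration and $r$ a weak equivalence. $(\mathcal M,\mathcal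 W,\mathrm{Fib})$ is a prefibration category if $(\mathcal M^{op},\mathcal W^{op},\mathrm{Fib}^{op})$ is a precofibration category; $A$ is fibrant if the map from $A$ to the terminal object is a fibration. $(\mathcal M,\mathcal W,\mathrm{Cof},\mathrm{Fib})$ is an ABC premodel category if $(\mathcal M,\mathcal W,\mathrm{Cof})$ is a precofibration category and $(\mathcal M,\mathcal W,\mathrm{Fib})$ is a prefibration category. *)

(* Defs.v *)
From HB Require Import structures.
From mathcomp Require Import all_boot all_order all_algebra.
From mathcomp Require Import boolp.

Set Implicit Arguments.
Unset Strict Implicit.
Unset Printing Implicit Defensive.

Import Order.TTheory GRing.Theory Num.Theory.
Local Open Scope ring_scope.

Declare Scope cat_scope.
Local Open Scope cat_scope.
Reserved Notation "g ∘ f" (at level 40, left associativity).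

(** * Categories *)

Record category : Type := Category {
  obj :> Type;
  hom : obj -> obj -> Type;
  idm : forall A, hom A A;
  cat_comp : forall A B C, hom B C -> hom A B -> hom A C;
  comp_assoc : forall A B C D (h : hom C D) (g : hom B C) (f : hom A B),
    cat_comp h (cat_comp g f) = cat_comp (cat_comp h g) f;
  comp_idl : forall A B (f : hom A B), cat_comp (idm B) f = f;
  comp_idr : forall A B (f : hom A B), cat_comp f (idm A) = f
}.
Arguments idm {c} A.
Notation "g ∘ f" := (cat_comp g f) : cat_scope.

Definition op (C : category) : category :=
  @Category C (fun A B => @hom C B A) (fun A => @idm C A)
    (fun A B D g f => f ∘ g)
    (fun A B D E h g f => esym (comp_assoc f g h))
    (fun A B f => comp_idr f) (fun A B f => comp_idl f).

Definition full_subcategory (C : category) (P : C -> Prop) : category :=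
  @Category {X : C | P X} (fun X Y => hom (sval X) (sval Y))
    (fun X => idm (sval X)) (fun X Y Z g f => g ∘ f)
    (fun X Y Z T h g f => comp_assoc h g f)
    (fun X Y f => comp_idl f) (fun X Y f => comp_idr f).

Definition morphism_class (C : category) : Type :=
  forall A B : C, hom A B -> Prop.

Definition op_class (C : category) (W : morphism_class C) :
  morphism_class (op C) := fun A B f => W B A f.

Definition is_monic (C : category) : morphism_class C := fun A B f =>
  forall Z (g h : hom Z A), f ∘ g = f ∘ h -> g = h.

Definition is_epic (C : category) : morphism_class C := fun A B f =>
  forall Z (g h : hom B Z), g ∘ f = h ∘ f -> g = h.

Definition is_iso (C : category) : morphism_class C := fun A B f =>
  exists g : hom B A, g ∘ f = idm A /\ f ∘ g = idm B.

Definition is_initial (C : category) (Z : C) : Prop :=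
  forall A, exists! f : hom Z A, True.

Definition is_terminal (C : category) (Z : C) : Prop :=
  forall A, exists! f : hom A Z, True.

Definition is_zero (C : category) (Z : C) : Prop :=
  is_initial Z /\ is_terminal Z.

Definition pointed (C : category) : Prop := exists Z : C, is_zero Z.

Definition is_pushout (C : category) (A B D P : C)
    (i : hom A B) (f : hom A D) (j : hom B P) (k : hom D P) : Prop :=
  j ∘ i = k ∘ f /\
  forall Q (b : hom B Q) (c : hom D Q), b ∘ i = c ∘ f ->
    exists! u : hom P Q, u ∘ j = b /\ u ∘ k = c.

(** * Precofibration, prefibration and ABC premodel categories *)

(* All initial objects are quantified over; under CF1 this does not depend on
   the choice of initial object, as cofibrations are stable under composition
   and isomorphisms with cofibrant domain are cofibrations. *)
Definition cofibrant (M : category) (Cof : morphism_class M) (A : M) : Prop :=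
  forall Z (i : hom Z A), is_initial Z -> Cof Z A i.

Definition fibrant (M : category) (Fib : morphism_class M) (A : M) : Prop :=
  forall Z (p : hom A Z), is_terminal Z -> Fib A Z p.

Lemma fibrantE (M : category) (Fib : morphism_class M) (A : M) :
  fibrant Fib A = cofibrant (op_class Fib) (A : op M).
Proof. by []. Qed.

Record is_precofibration_category (M : category)
    (W Cof : morphism_class M) : Prop := {
  CF1_initial : exists Z : M, is_initial Z /\ cofibrant Cof Z;
  CF1_comp : forall A B D (g : hom B D) (f : hom A B),
    Cof _ _ f -> Cof _ _ g -> Cof _ _ (g ∘ f);
  CF1_iso_weq : forall (A B : M) (f : hom A B), is_iso f -> W _ _ f;
  CF1_iso_cof : forall (A B : M) (f : hom A B),
    is_iso f -> cofibrant Cof A -> W _ _ f /\ Cof _ _ f;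
  CF2 : forall A B D (g : hom B D) (f : hom A B),
    [/\ W _ _ f -> W _ _ g -> W _ _ (g ∘ f),
        W _ _ f -> W _ _ (g ∘ f) -> W _ _ g
      & W _ _ g -> W _ _ (g ∘ f) -> W _ _ f];
  CF3_exists : forall A B D (i : hom A B) (f : hom A D),
    cofibrant Cof A -> cofibrant Cof D -> Cof _ _ i ->
    exists P (j : hom B P) (k : hom D P), is_pushout i f j k;
  CF3_cof : forall A B D P (i : hom A B) (f : hom A D)
      (j : hom B P) (k : hom D P),
    cofibrant Cof A -> cofibrant Cof D -> Cof _ _ i ->
    is_pushout i f j k -> Cof _ _ k;
  CF3_trivial : forall A B D P (i : hom A B) (f : hom A D)
      (j : hom B P) (k : hom D P),
    cofibrant Cof A -> cofibrant Cof D -> W _ _ i /\ Cof _ _ i ->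
    is_pushout i f j k -> W _ _ k /\ Cof _ _ k;
  CF4 : forall A B (f : hom A B), cofibrant Cof A ->
    exists A' (r : hom A' B) (f' : hom A A'),
      [/\ f = r ∘ f', Cof _ _ f' & W _ _ r]
}.

Definition is_prefibration_category (M : category)
    (W Fib : morphism_class M) : Prop :=
  is_precofibration_category (op_class W) (op_class Fib).

Definition is_ABC_premodel_category (M : category)
    (W Cof Fib : morphism_class M) : Prop :=
  is_precofibration_category W Cof /\ is_prefibration_category W Fib.

(** * Abelian categories *)

(* [GRing.Zmodule] includes a choice operator, which every type carries under
   the classical axioms of boolp; hence this is no restriction on the hom
   groups. *)
Record hom_groups : Type := HomGroups {
  hg_cat :> category;
  hg_zmod : forall A B : hg_cat, GRing.Zmodule (hom A B)
}.
HB.instance Definition _ (C : hom_groups) (A B : C) := hg_zmod A B.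

Record preadditive : Type := Preadditive {
  pre_groups :> hom_groups;
  comp_addl : forall (A B C : pre_groups) (g h : hom B C) (f : hom A B),
    (g + h) ∘ f = g ∘ f + h ∘ f;
  comp_addr : forall (A B C : pre_groups) (g : hom B C) (f h : hom A B),
    g ∘ (f + h) = g ∘ f + g ∘ h
}.

Definition is_biproduct (C : preadditive) (A B P : C)
    (i1 : hom A P) (i2 : hom B P) (p1 : hom P A) (p2 : hom P B) : Prop :=
  [/\ p1 ∘ i1 = idm A, p2 ∘ i2 = idm B & i1 ∘ p1 + i2 ∘ p2 = idm P].

Definition is_kernel (C : preadditive) (A B K : C)
    (f : hom A B) (k : hom K A) : Prop :=
  f ∘ k = 0 /\
  forall Z (h : hom Z A), f ∘ h = 0 -> exists! u : hom Z K, k ∘ u = h.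

Definition is_cokernel (C : preadditive) (A B Q : C)
    (f : hom A B) (q : hom B Q) : Prop :=
  q ∘ f = 0 /\
  forall Z (h : hom B Z), h ∘ f = 0 -> exists! u : hom Q Z, u ∘ q = h.

Record abelian_category : Type := Abelian {
  ab_pre :> preadditive;
  ab_zero : exists Z : ab_pre, is_zero Z;
  ab_biprod : forall A B : ab_pre, exists (P : ab_pre)
    (i1 : hom A P) (i2 : hom B P) (p1 : hom P A) (p2 : hom P B),
    is_biproduct i1 i2 p1 p2;
  ab_ker : forall (A B : ab_pre) (f : hom A B),
    exists (K : ab_pre) (k : hom K A), is_kernel f k;
  ab_coker : forall (A B : ab_pre) (f : hom A B),
    exists (Q : ab_pre) (q : hom B Q), is_cokernel f q;
  ab_monic : forall (A B : ab_pre) (f : hom A B), is_monic f ->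
    exists (C : ab_pre) (g : hom B C), is_kernel g f;
  ab_epic : forall (A B : ab_pre) (f : hom A B), is_epic f ->
    exists (C : ab_pre) (g : hom C A), is_cokernel g f
}.

Section PreadditiveTheory.
Context {C : preadditive}.

Lemma comp0m (A B D : C) (f : hom A B) : (0 : hom B D) ∘ f = 0.
Proof. by apply: (@addrI _ (0 ∘ f)); rewrite -comp_addl !addr0. Qed.

Lemma compm0 (A B D : C) (g : hom B D) : g ∘ (0 : hom A B) = 0.
Proof. by apply: (@addrI _ (g ∘ 0)); rewrite -comp_addr !addr0. Qed.

End PreadditiveTheory.

Section ChosenKernels.
Context {C : abelian_category}.

Definition kernel (A B : C) (f : hom A B) : C := sval (cid (ab_ker f)).

Definition ker_inc (A B : C) (f : hom A B) : hom (kernel f) A :=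
  sval (cid (svalP (cid (ab_ker f)))).

Lemma ker_incP (A B : C) (f : hom A B) : is_kernel f (ker_inc f).
Proof. exact: svalP (cid (svalP (cid (ab_ker f)))). Qed.

Lemma ker_lift_ex (A B Z : C) (f : hom A B) (h : hom Z A) :
  f ∘ h = 0 -> exists u : hom Z (kernel f), ker_inc f ∘ u = h.
Proof. by case: (ker_incP f) => _ /[apply] -[u [uP _]]; exists u. Qed.

Definition ker_lift (A B Z : C) (f : hom A B) (h : hom Z A) (fh : f ∘ h = 0) :
  hom Z (kernel f) := sval (cid (ker_lift_ex fh)).

Lemma ker_liftK (A B Z : C) (f : hom A B) (h : hom Z A) (fh : f ∘ h = 0) :
  ker_inc f ∘ ker_lift fh = h.
Proof. exact: svalP (cid (ker_lift_ex fh)). Qed.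

Definition cokernel (A B : C) (f : hom A B) : C := sval (cid (ab_coker f)).

Definition coker_proj (A B : C) (f : hom A B) : hom B (cokernel f) :=
  sval (cid (svalP (cid (ab_coker f)))).

Lemma coker_projP (A B : C) (f : hom A B) : is_cokernel f (coker_proj f).
Proof. exact: svalP (cid (svalP (cid (ab_coker f)))). Qed.

Lemma coker_desc_ex (A B Z : C) (f : hom A B) (h : hom B Z) :
  h ∘ f = 0 -> exists u : hom (cokernel f) Z, u ∘ coker_proj f = h.
Proof. by case: (coker_projP f) => _ /[apply] -[u [uP _]]; exists u. Qed.

Definition coker_desc (A B Z : C) (f : hom A B) (h : hom B Z)
  (hf : h ∘ f = 0) : hom (cokernel f) Z := sval (cid (coker_desc_ex hf)).

Lemma coker_descK (A B Z : C) (f : hom A B) (h : hom B Z) (hf : h ∘ f = 0) :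
  coker_desc hf ∘ coker_proj f = h.
Proof. exact: svalP (cid (coker_desc_ex hf)). Qed.

Lemma ker_inc_monic (A B : C) (f : hom A B) : is_monic (ker_inc f).
Proof.
move=> Z g h e; have [f0 kP] := ker_incP f.
have fh0 : f ∘ (ker_inc f ∘ h) = 0 by rewrite comp_assoc f0 comp0m.
by have [u [_ uU]] := kP _ _ fh0; rewrite -(uU g e) (uU h).
Qed.

End ChosenKernels.

(** * Chain complexes *)

(* The differential X_i -> X_(i-1) is indexed by all pairs (i, j) with
   i = j + 1, to avoid transports along equalities between degrees; the proof
   of i = j + 1 is irrelevant, int having decidable equality. *)
Record chain_complex (C : preadditive) : Type := ChainComplex {
  cc_obj :> int -> C;
  cc_diff : forall i j : int, i = j + 1 -> hom (cc_obj i) (cc_obj j);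
  diff_diff : forall (i j k : int) (ij : i = j + 1) (jk : j = k + 1),
    cc_diff jk ∘ cc_diff ij = 0
}.

Record chain_map (C : preadditive) (X Y : chain_complex C) : Type := ChainMap {
  cm_fun :> forall i : int, hom (X i) (Y i);
  cm_comm : forall (i j : int) (ij : i = j + 1),
    cm_fun j ∘ cc_diff X ij = cc_diff Y ij ∘ cm_fun i
}.

Section ChainCategory.
Context {C : preadditive}.
Implicit Types X Y Z : chain_complex C.

Lemma chain_map_ext X Y (f g : chain_map X Y) : (forall i, f i = g i) -> f = g.
Proof.
case: f g => [f fP] [g gP] /= e.
have {}e : f = g by apply: functional_extensionality_dep.
by case: _ / e gP => gP; rewrite (Prop_irrelevance fP gP).
Qed.

Lemma chain_id_comm X (i j : int) (ij : i = j + 1) :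
  idm (X j) ∘ cc_diff X ij = cc_diff X ij ∘ idm (X i).
Proof. by rewrite comp_idl comp_idr. Qed.

Definition chain_id X : chain_map X X := ChainMap (@chain_id_comm X).

Lemma chain_comp_comm X Y Z (g : chain_map Y Z) (f : chain_map X Y)
    (i j : int) (ij : i = j + 1) :
  (g j ∘ f j) ∘ cc_diff X ij = cc_diff Z ij ∘ (g i ∘ f i).
Proof. by rewrite -comp_assoc cm_comm !comp_assoc cm_comm. Qed.

Definition chain_comp X Y Z (g : chain_map Y Z) (f : chain_map X Y) :
  chain_map X Z := ChainMap (chain_comp_comm g f).

Lemma chain_comp_assoc X Y Z T (h : chain_map Z T) (g : chain_map Y Z)
    (f : chain_map X Y) :
  chain_comp h (chain_comp g f) = chain_comp (chain_comp h g) f.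
Proof. by apply: chain_map_ext => i; apply: comp_assoc. Qed.

Lemma chain_comp_idl X Y (f : chain_map X Y) : chain_comp (chain_id Y) f = f.
Proof. by apply: chain_map_ext => i; apply: comp_idl. Qed.

Lemma chain_comp_idr X Y (f : chain_map X Y) : chain_comp f (chain_id X) = f.
Proof. by apply: chain_map_ext => i; apply: comp_idr. Qed.

End ChainCategory.

Definition Ch (C : preadditive) : category :=
  Category (@chain_comp_assoc C) (@chain_comp_idl C) (@chain_comp_idr C).

Definition bounded_below (C : preadditive) (X : Ch C) : Prop :=
  exists N : int, forall n : int, n < N -> is_zero (X n).

Definition bounded_above (C : preadditive) (X : Ch C) : Prop :=
  exists N : int, forall n : int, N < n -> is_zero (X n).

Definition bounded (C : preadditive) (X : Ch C) : Prop :=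
  bounded_below X /\ bounded_above X.

Definition Ch_plus (C : preadditive) : category :=
  full_subcategory (@bounded_below C).
Definition Ch_minus (C : preadditive) : category :=
  full_subcategory (@bounded_above C).
Definition Ch_bounded (C : preadditive) : category :=
  full_subcategory (@bounded C).

(** * Homology and quasi-isomorphisms *)

Section Homology.
Context {C : abelian_category}.
Implicit Types X Y : chain_complex C.

Definition diff_in X (n : int) : hom (X (n + 1)) (X n) := cc_diff X erefl.
Definition diff_out X (n : int) : hom (X n) (X (n - 1)) :=
  cc_diff X (esym (subrK 1 n)).

Lemma diff_out_in X n : diff_out X n ∘ diff_in X n = 0.
Proof. exact: diff_diff. Qed.

Definition cycles X (n : int) : C := kernel (diff_out X n).

Definition to_cycles X (n : int) : hom (X (n + 1)) (cycles X n) :=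
  ker_lift (diff_out_in X n).

Definition homology X (n : int) : C := cokernel (to_cycles X n).

Lemma cycles_map_subproof X Y (f : chain_map X Y) n :
  diff_out Y n ∘ (f n ∘ ker_inc (diff_out X n)) = 0.
Proof.
rewrite comp_assoc -cm_comm -comp_assoc.
by case: (ker_incP (diff_out X n)) => -> _; rewrite compm0.
Qed.

Definition cycles_map X Y (f : chain_map X Y) (n : int) :
  hom (cycles X n) (cycles Y n) := ker_lift (cycles_map_subproof f n).

Lemma homology_map_subproof X Y (f : chain_map X Y) n :
  (coker_proj (to_cycles Y n) ∘ cycles_map f n) ∘ to_cycles X n = 0.
Proof.
have -> : coker_proj (to_cycles Y n) ∘ cycles_map f n ∘ to_cycles X n =
    coker_proj (to_cycles Y n) ∘ (to_cycles Y n ∘ f (n + 1)).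
  rewrite -comp_assoc; congr (_ ∘ _); apply: ker_inc_monic.
  by rewrite !comp_assoc !ker_liftK -comp_assoc ker_liftK cm_comm.
rewrite comp_assoc.
by case: (coker_projP (to_cycles Y n)) => -> _; rewrite comp0m.
Qed.

Definition homology_map X Y (f : chain_map X Y) (n : int) :
  hom (homology X n) (homology Y n) := coker_desc (homology_map_subproof f n).

End Homology.

Definition quasi_iso (C : abelian_category) : morphism_class (Ch C) :=
  fun X Y f => forall n : int, is_iso (homology_map f n).

Definition restrict_class (C : category) (P : C -> Prop)
    (W : morphism_class C) : morphism_class (full_subcategory P) :=
  fun X Y f => W (sval X) (sval Y) f.

(* Main.v *)
(* Weak equivalences are detected on local elements: a chain map is a
   quasi-isomorphism iff it is injective and surjective on homology classes of
   maps Z -> X_n, where equations need only be solved after composing with an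
   epic Z' -> Z.  In these terms, stability of trivial cofibrations (fibrations)
   under pushout (pullback) is a diagram chase on the degreewise pushouts
   (pullbacks).  For the factorizations of f : X -> Y, let K(G) be the
   contractible complex with K(G)_n = G_n + G_(n-1) and d(x, y) = (y, 0).  Then
   X -> Y + K(X) -> Y, with first map x |-> (f x, (x, dx)), and
   X -> X + K(Y[1]) -> Y, with second map (x, (y, y')) |-> f x + dy + y', are
   the required ones.  All these constructions enlarge supports by at most one
   degree, hence stay within bounded (below, above) complexes. *)

Require Import Defs.
From mathcomp Require Import all_boot all_order all_algebra.
From mathcomp Require Import boolp zify.
Import Defs.

Set Implicit Arguments.
Unset Strict Implicit.
Unset Printing Implicit Defensive.

Import Order.TTheory GRing.Theory Num.Theory.
Local Open Scope ring_scope.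
Local Open Scope cat_scope.

(** * Arbitrary categories *)

Definition is_pullback (C : category) (A B D P : C)
    (p : hom B A) (f : hom D A) (j : hom P B) (k : hom P D) : Prop :=
  p ∘ j = f ∘ k /\
  forall Q (b : hom Q B) (c : hom Q D), p ∘ b = f ∘ c ->
    exists! u : hom Q P, j ∘ u = b /\ k ∘ u = c.

Lemma unique_existsP (T : Type) (P : T -> Prop) :
  (exists! x, P x) <-> (exists x, P x) /\ (forall x y, P x -> P y -> x = y).
Proof.
split=> [[x [Px xU]]|[[x Px] PU]]; last by exists x; split=> // y; apply: PU.
by split=> [|y z /xU <- /xU <-]; first exists x.
Qed.

Section Category.
Context {C : category}.

Lemma is_iso_comp (A B D : C) (g : hom B D) (f : hom A B) :
  is_iso f -> is_iso g -> is_iso (g ∘ f).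
Proof.
move=> [f' [f'f ff']] [g' [g'g gg']]; exists (f' ∘ g'); split.
  by rewrite comp_assoc -(comp_assoc f') g'g comp_idr.
by rewrite comp_assoc -(comp_assoc g) ff' comp_idr.
Qed.

Lemma is_iso_inv (A B : C) (f : hom A B) (g : hom B A) :
  g ∘ f = idm A -> f ∘ g = idm B -> is_iso g.
Proof. by exists f. Qed.

Lemma is_iso_2of3 (A B D : C) (g : hom B D) (f : hom A B) :
  [/\ is_iso f -> is_iso g -> is_iso (g ∘ f),
      is_iso f -> is_iso (g ∘ f) -> is_iso g
    & is_iso g -> is_iso (g ∘ f) -> is_iso f].
Proof.
split; first exact: is_iso_comp.
  move=> [f' [f'f ff']] gf_iso; have -> : g = (g ∘ f) ∘ f'.
    by rewrite -comp_assoc ff' comp_idr.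
  by apply: is_iso_comp gf_iso; apply: is_iso_inv f'f ff'.
move=> [g' [g'g gg']] gf_iso; have -> : f = g' ∘ (g ∘ f).
  by rewrite comp_assoc g'g comp_idl.
by apply: is_iso_comp gf_iso _; apply: is_iso_inv g'g gg'.
Qed.

Lemma split_monic (A B : C) (f : hom A B) (g : hom B A) :
  g ∘ f = idm A -> is_monic f.
Proof.
by move=> gf Z u v /(congr1 (cat_comp g)); rewrite !comp_assoc gf !comp_idl.
Qed.

Lemma split_epic (A B : C) (f : hom A B) (g : hom B A) :
  f ∘ g = idm B -> is_epic f.
Proof.
move=> fg Z u v /(congr1 (fun h => h ∘ g)).
by rewrite -!comp_assoc fg !comp_idr.
Qed.

Lemma is_monic_comp (A B D : C) (g : hom B D) (f : hom A B) :
  is_monic f -> is_monic g -> is_monic (g ∘ f).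
Proof.
by move=> f_mono g_mono Z u v; rewrite -!comp_assoc => /g_mono/f_mono.
Qed.

Lemma is_epic_comp (A B D : C) (g : hom B D) (f : hom A B) :
  is_epic f -> is_epic g -> is_epic (g ∘ f).
Proof.
by move=> f_epi g_epi Z u v; rewrite !comp_assoc => /f_epi/g_epi.
Qed.

Lemma is_epic_idm (A : C) : is_epic (idm A).
Proof. exact: split_epic (comp_idl _). Qed.

Lemma pushout_unique (A B D P P' : C) (i : hom A B) (f : hom A D)
    (j : hom B P) (k : hom D P) (j' : hom B P') (k' : hom D P') :
  is_pushout i f j k -> is_pushout i f j' k' ->
  exists u : hom P P', is_iso u /\ u ∘ k = k'.
Proof.
move=> [ji UP] [ji' UP'].
have [u [[uj uk] _]] := UP _ _ _ ji'.
have [v [[vj vk] _]] := UP' _ _ _ ji.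
exists u; split=> //; exists v; split.
  have /unique_existsP[_ U] := UP _ _ _ ji.
  by apply: U; rewrite ?comp_idl // -!comp_assoc uj uk.
have /unique_existsP[_ U] := UP' _ _ _ ji'.
by apply: U; rewrite ?comp_idl // -!comp_assoc vj vk.
Qed.

(** The identity of an initial object factors through the zero object, so any two maps into it
    agree. With monics as cofibrations this makes every object cofibrant; in the opposite category
    it gives fibrancy. *)
Lemma initial_monic (Z A : C) (i : hom Z A) :
  pointed C -> is_initial Z -> is_monic i.
Proof.
move=> [O [Oini Oter]] Zini W g h _.
have /unique_existsP[[u _] _] := Zini O.
have /unique_existsP[[v _] _] := Oini Z.
have /unique_existsP[_ ZU] := Zini Z.
have /unique_existsP[_ OU] := Oter W.
rewrite -(comp_idl g) -(comp_idl h) (ZU (idm Z) (v ∘ u)) // -!comp_assoc.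
by rewrite (OU (u ∘ g) (u ∘ h)).
Qed.

(* Pushouts being unique up to isomorphism, CF3 may be checked on one pushout
   of each diagram. *)
Lemma monic_precofibration (W : morphism_class C) :
  pointed C ->
  (forall (A B : C) (f : hom A B), is_iso f -> W _ _ f) ->
  (forall (A B D : C) (g : hom B D) (f : hom A B),
    [/\ W _ _ f -> W _ _ g -> W _ _ (g ∘ f),
        W _ _ f -> W _ _ (g ∘ f) -> W _ _ g
      & W _ _ g -> W _ _ (g ∘ f) -> W _ _ f]) ->
  (forall (A B D : C) (i : hom A B) (f : hom A D), is_monic i ->
    exists P (j : hom B P) (k : hom D P),
      [/\ is_pushout i f j k, is_monic k & W _ _ i -> W _ _ k]) ->
  (forall (A B : C) (f : hom A B),
    exists A' (r : hom A' B) (f' : hom A A'),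
      [/\ f = r ∘ f', is_monic f' & W _ _ r]) ->
  is_precofibration_category W (@is_monic C).
Proof.
move=> C0 isoW W23 po fact.
have cof (X : C) : cofibrant (@is_monic C) X.
  by move=> Z i; apply: initial_monic.
have iso_monic (A B : C) (f : hom A B) : is_iso f -> is_monic f.
  by move=> [g [gf _]]; apply: split_monic gf.
have poW (A B D P : C) (i : hom A B) (f : hom A D) (j : hom B P) (k : hom D P) :
    is_monic i -> is_pushout i f j k -> is_monic k /\ (W _ _ i -> W _ _ k).
  move=> im P_po; have [P' [j' [k' [P'_po k'm k'W]]]] := po _ _ _ i f im.
  have [u [uiso <-]] := pushout_unique P'_po P_po; split.
    by apply: is_monic_comp (iso_monic _ _ _ _).
  by case: (W23 _ _ _ u k') => + _ _ => WuW /k'W /WuW; apply; apply: isoW.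
split.
- by case: C0 => Z [Zini _]; exists Z.
- by move=> A B D g f; apply: is_monic_comp.
- exact: isoW.
- by move=> A B f fiso _; split; [apply: isoW|apply: iso_monic].
- exact: W23.
- by move=> A B D i f _ _ /(po _ _ _ _ f)[P [j [k [? _ _]]]]; exists P, j, k.
- by move=> A B D P i f j k _ _ im /poW[].
- by move=> A B D P i f j k _ _ [iW im] /poW[] // ? kW; split; first exact: kW.
- by move=> A B f _; apply: fact.
Qed.

End Category.

(** * Preadditive and abelian categories *)

Section Preadditive.
Context {C : preadditive}.
Implicit Types X Y Z : C.

Lemma compmN X Y Z (g : hom Y Z) (f : hom X Y) : g ∘ (- f) = - (g ∘ f).
Proof.
by apply: (@addrI _ (g ∘ f)); rewrite -comp_addr !subrr compm0.
Qed.

Lemma compNm X Y Z (g : hom Y Z) (f : hom X Y) : (- g) ∘ f = - (g ∘ f).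
Proof.
by apply: (@addrI _ (g ∘ f)); rewrite -comp_addl !subrr comp0m.
Qed.

Definition compE := (@comp_addl C, @comp_addr C, @compmN, @compNm,
  @comp0m C, @compm0 C, @comp_idl C, @comp_idr C).

Lemma is_monicP X Y (f : hom X Y) :
  is_monic f <-> forall Z (u : hom Z X), f ∘ u = 0 -> u = 0.
Proof.
split=> [fm Z u fu|fP Z u v e]; first by apply: fm; rewrite fu compm0.
by apply/eqP; rewrite -subr_eq0; apply/eqP/fP; rewrite !compE e subrr.
Qed.

Lemma is_epicP X Y (f : hom X Y) :
  is_epic f <-> forall Z (u : hom Y Z), u ∘ f = 0 -> u = 0.
Proof.
split=> [fm Z u fu|fP Z u v e]; first by apply: fm; rewrite fu comp0m.
by apply/eqP; rewrite -subr_eq0; apply/eqP/fP; rewrite !compE e subrr.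
Qed.

Lemma is_zeroP X : is_zero X <-> idm X = 0.
Proof.
split=> [[/(_ X)/unique_existsP[_ U] _]|X0]; first exact: U.
split=> Y; exists 0; split=> // f _.
  by rewrite -(comp_idr f) X0 compm0.
by rewrite -(comp_idl f) X0 comp0m.
Qed.

Lemma zero_source X Y (f : hom X Y) : is_zero X -> f = 0.
Proof. by move=> /is_zeroP X0; rewrite -(comp_idr f) X0 compm0. Qed.

Lemma zero_target X Y (f : hom X Y) : is_zero Y -> f = 0.
Proof. by move=> /is_zeroP Y0; rewrite -(comp_idl f) Y0 comp0m. Qed.

(** The identity and the zero map of [P] agree on both legs. This controls the support of degreewise
    pushouts. *)
Lemma pushout_zero X Y D P (i : hom X Y) (f : hom X D)
    (j : hom Y P) (k : hom D P) :
  is_pushout i f j k -> is_zero Y -> is_zero D -> is_zero P.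
Proof.
move=> [ji UP] Y0 D0; apply/is_zeroP.
have /unique_existsP[_] := UP _ _ _ ji; apply; rewrite !compE //.
by rewrite (zero_source j Y0) (zero_source k D0).
Qed.

Lemma pullback_zero X Y D P (i : hom Y X) (f : hom D X)
    (j : hom P Y) (k : hom P D) :
  is_pullback i f j k -> is_zero Y -> is_zero D -> is_zero P.
Proof.
move=> [ji UP] Y0 D0; apply/is_zeroP.
have /unique_existsP[_] := UP _ _ _ ji; apply; rewrite !compE //.
by rewrite (zero_target j Y0) (zero_target k D0).
Qed.

End Preadditive.

(** * Biproducts, local elements, pullbacks and pushouts in an abelian category *)

Section Abelian.
Context {A : abelian_category}.
Implicit Types X Y Z B D E K P Q W : A.

(** Packing the object with its four maps lets a single choice select them coherently. *)
Lemma biprod_exists X Y : exists t : {P : A &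
    ((hom X P * hom Y P) * (hom P X * hom P Y))%type},
  is_biproduct (projT2 t).1.1 (projT2 t).1.2 (projT2 t).2.1 (projT2 t).2.2.
Proof.
have [P [i1 [i2 [p1 [p2 h]]]]] := ab_biprod X Y.
by exists (existT _ P ((i1, i2), (p1, p2))).
Qed.

Definition biprod_data X Y := sval (cid (biprod_exists X Y)).
Definition biprod X Y : A := projT1 (biprod_data X Y).
Definition in1 X Y : hom X (biprod X Y) := (projT2 (biprod_data X Y)).1.1.
Definition in2 X Y : hom Y (biprod X Y) := (projT2 (biprod_data X Y)).1.2.
Definition pr1 X Y : hom (biprod X Y) X := (projT2 (biprod_data X Y)).2.1.
Definition pr2 X Y : hom (biprod X Y) Y := (projT2 (biprod_data X Y)).2.2.
Arguments in1 {X Y}.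
Arguments in2 {X Y}.
Arguments pr1 {X Y}.
Arguments pr2 {X Y}.

Lemma biprodP X Y : @is_biproduct A X Y _ in1 in2 pr1 pr2.
Proof. exact: svalP (cid (biprod_exists X Y)). Qed.

Lemma pr1_in1 X Y : (pr1 : hom (biprod X Y) X) ∘ in1 = idm X.
Proof. by case: (biprodP X Y). Qed.

Lemma pr2_in2 X Y : (pr2 : hom (biprod X Y) Y) ∘ in2 = idm Y.
Proof. by case: (biprodP X Y). Qed.

Lemma biprod_id X Y : in1 ∘ pr1 + in2 ∘ pr2 = idm (biprod X Y).
Proof. by case: (biprodP X Y). Qed.

(** Inserting [biprod_id] between the two maps shows that the cross term equals its own double. *)
Lemma pr1_in2 X Y : (pr1 : hom (biprod X Y) X) ∘ in2 = 0.
Proof.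
apply: (@addrI _ (pr1 ∘ in2)); rewrite addr0.
rewrite -[in RHS](comp_idl in2) -biprod_id !compE -!comp_assoc pr2_in2.
by rewrite comp_assoc pr1_in1 !compE.
Qed.

Lemma pr2_in1 X Y : (pr2 : hom (biprod X Y) Y) ∘ in1 = 0.
Proof.
apply: (@addrI _ (pr2 ∘ in1)); rewrite addr0.
rewrite -[in RHS](comp_idl in1) -biprod_id !compE -!comp_assoc pr1_in1.
by rewrite comp_idr (comp_assoc pr2 in2) pr2_in2 !compE.
Qed.

Lemma pr1_in1K X Y Z (f : hom Z X) : (pr1 : hom (biprod X Y) X) ∘ (in1 ∘ f) = f.
Proof. by rewrite comp_assoc pr1_in1 comp_idl. Qed.

Lemma pr2_in2K X Y Z (f : hom Z Y) : (pr2 : hom (biprod X Y) Y) ∘ (in2 ∘ f) = f.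
Proof. by rewrite comp_assoc pr2_in2 comp_idl. Qed.

Lemma pr1_in2_0 X Y Z (f : hom Z Y) : (pr1 : hom (biprod X Y) X) ∘ (in2 ∘ f) = 0.
Proof. by rewrite comp_assoc pr1_in2 comp0m. Qed.

Lemma pr2_in1_0 X Y Z (f : hom Z X) : (pr2 : hom (biprod X Y) Y) ∘ (in1 ∘ f) = 0.
Proof. by rewrite comp_assoc pr2_in1 comp0m. Qed.

Definition biprodE := (pr1_in1, pr2_in2, pr1_in2, pr2_in1,
  pr1_in1K, pr2_in2K, pr1_in2_0, pr2_in1_0).

Lemma biprod_zero X Y : is_zero X -> is_zero Y -> is_zero (biprod X Y).
Proof.
move=> X0 Y0; apply/is_zeroP.
by rewrite -biprod_id (zero_target pr1 X0) (zero_target pr2 Y0) !compE addr0.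
Qed.

(** [f] is the cokernel of some [g], and [g] factors through [k]; whatever kills [k] therefore kills
    [g]. *)
Lemma epic_cokernel X Y K (f : hom X Y) (k : hom K X) :
  is_epic f -> is_kernel f k -> is_cokernel k f.
Proof.
move=> /ab_epic[D [g [fg gP]]] [fk kP]; split=> // Z h hk.
apply: gP; have [u [<- _]] := kP _ _ fg.
by rewrite comp_assoc hk comp0m.
Qed.

Lemma monic_kernel X Y Q (f : hom X Y) (q : hom Y Q) :
  is_monic f -> is_cokernel f q -> is_kernel q f.
Proof.
move=> /ab_monic[D [g [gf gP]]] [qf qP]; split=> // Z h qh.
apply: gP; have [u [<- _]] := qP _ _ gf.
by rewrite -comp_assoc qh compm0.
Qed.

Lemma coker_proj_epic X Y (f : hom X Y) : is_epic (coker_proj f).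
Proof.
move=> Z g h e; have [qf qP] := coker_projP f.
have gqf : (g ∘ coker_proj f) ∘ f = 0 by rewrite -comp_assoc qf compm0.
by have /unique_existsP[_ U] := qP _ _ gqf; apply: U.
Qed.

Lemma monic_epic_iso X Y (f : hom X Y) : is_monic f -> is_epic f -> is_iso f.
Proof.
move=> fm fe; have [D [g [gf gP]]] := ab_monic fm.
have g0 : g ∘ idm Y = 0.
  by rewrite comp_idr; apply: fe; rewrite gf comp0m.
have [u [fu _]] := gP _ _ g0; exists u; split=> //; apply: fm.
by rewrite comp_assoc fu comp_idl comp_idr.
Qed.

(* Base change of an epic along [u]: elements of [D] lift to [B] locally. *)
Lemma epic_lift B D Z (q : hom B D) (u : hom Z D) : is_epic q ->
  exists Z' (e : hom Z' Z) (b : hom Z' B), is_epic e /\ q ∘ b = u ∘ e.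
Proof.
move=> qe; pose phi := q ∘ pr1 - u ∘ pr2.
have phi_in1 : phi ∘ in1 = q.
  by rewrite /phi !compE -!comp_assoc !biprodE !compE subr0.
have phi_epi : is_epic phi.
  move=> W g h /(congr1 (fun v => v ∘ in1)).
  by rewrite -!comp_assoc phi_in1 => /qe.
have phi_coker := epic_cokernel phi_epi (ker_incP phi).
exists (kernel phi), (pr2 ∘ ker_inc phi), (pr1 ∘ ker_inc phi); split.
  apply/is_epicP => W v; rewrite comp_assoc => vk.
  (* [v ∘ pr2] kills the kernel of [phi], so it is [w ∘ phi]; restricting to [in1] gives
     [w ∘ q = 0]. *)
  have [_ /(_ _ _ vk)[w [wphi _]]] := phi_coker.
  have w0 : w = 0.
    apply: qe; rewrite -phi_in1 comp_assoc wphi.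
    by rewrite -!comp_assoc pr2_in1 !compE.
  rewrite -(comp_idr v) -(pr2_in2 B Z) comp_assoc -wphi w0.
  by rewrite !comp0m.
case: (ker_incP phi) => /eqP; rewrite !compE subr_eq0 -!comp_assoc.
by move=> /eqP.
Qed.

(* The kernel of the cokernel of [t] is its image: the comparison map is epic,
   since the kernel of any map killing it also receives [t]. *)
Lemma coker_exact X Y Z (t : hom X Y) (w : hom Z Y) :
  coker_proj t ∘ w = 0 ->
  exists Z' (e : hom Z' Z) (x : hom Z' X), is_epic e /\ t ∘ x = w ∘ e.
Proof.
move=> qw; set m := ker_inc (coker_proj t).
have m_mono : is_monic m by apply: ker_inc_monic.
have [qt qP] := coker_projP t.
have [_ mP] := ker_incP (coker_proj t).
have [t' [mt' _]] := mP _ _ qt; have [w' [mw' _]] := mP _ _ qw.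
suff t'_epi : is_epic t'.
  have [Z' [e [x [e_epi t'x]]]] := epic_lift w' t'_epi.
  by exists Z', e, x; split; rewrite // -mt' -mw' -!comp_assoc t'x.
apply/is_epicP => W g gt'.
have [gk kP] := ker_incP g; have [t'' [kt'' _]] := kP _ _ gt'.
set k := ker_inc g in gk kP kt''.
have mk_mono : is_monic (m ∘ k).
  by apply: is_monic_comp => //; apply: ker_inc_monic.
(* [c] kills [t], hence factors through [coker_proj t] and kills [m]. Thus [m] factors through its
   subobject [m ∘ k], which splits [k] and forces [g = 0]. *)
have [D [c [cmk cP]]] := ab_monic mk_mono.
have ct : c ∘ t = 0.
  by rewrite -mt' -kt'' 2!comp_assoc -(comp_assoc c) cmk comp0m.
have [c' [c'q _]] := qP _ _ ct.
have cm : c ∘ m = 0.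
  rewrite -c'q -comp_assoc; case: (ker_incP (coker_proj t)) => -> _.
  by rewrite compm0.
have [v [mkv _]] := cP _ _ cm.
have kv : k ∘ v = idm _.
  by apply: m_mono; rewrite comp_assoc mkv comp_idr.
by rewrite -(comp_idr g) -kv comp_assoc gk comp0m.
Qed.

Lemma pullback_exists B D E (p : hom B E) (f : hom D E) :
  exists P (j : hom P B) (k : hom P D), is_pullback p f j k.
Proof.
pose phi := p ∘ pr1 - f ∘ pr2.
have [phik kP] := ker_incP phi.
have phiE Z (w : hom Z (biprod B D)) :
    phi ∘ w = 0 <-> p ∘ (pr1 ∘ w) = f ∘ (pr2 ∘ w).
  rewrite /phi !compE -!comp_assoc.
  by split=> [/eqP|->]; rewrite ?subrr // subr_eq0 => /eqP.
exists (kernel phi), (pr1 ∘ ker_inc phi), (pr2 ∘ ker_inc phi); split.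
  exact/phiE.
move=> Q b c pbfc; apply/unique_existsP; split.
  have /kP[u [ku _]] : phi ∘ (in1 ∘ b + in2 ∘ c) = 0.
    by apply/phiE; rewrite !(compE, biprodE) addr0 add0r.
  by exists u; rewrite -!comp_assoc ku !(compE, biprodE) addr0 add0r.
move=> u v [bu cu] [bv cv]; apply: (@ker_inc_monic _ _ _ phi).
rewrite -(comp_idl (_ ∘ u)) -(comp_idl (_ ∘ v)) -biprod_id !compE.
by rewrite -!comp_assoc in bu cu bv cv *; rewrite bu cu bv cv.
Qed.

(** A local lift of [f] along [p] induces a map [u] into [P] with [k ∘ u] epic. *)
Lemma pullback_epic B D E P (p : hom B E) (f : hom D E)
    (j : hom P B) (k : hom P D) :
  is_pullback p f j k -> is_epic p -> is_epic k.
Proof.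
move=> [_ UP] pe; have [Z [e [b [ee pb]]]] := epic_lift f pe.
have [u [[_ ku] _]] := UP _ _ _ pb.
by move=> W g h /(congr1 (fun v => v ∘ u)); rewrite -!comp_assoc ku => /ee.
Qed.

(** Joint surjectivity of [j] and [k], in terms of local elements. *)
Definition pushout_generated B D P (j : hom B P) (k : hom D P) :=
  forall Z (p : hom Z P), exists Z' (e : hom Z' Z) (b : hom Z' B) (d : hom Z' D),
    is_epic e /\ p ∘ e = j ∘ b + k ∘ d.

Definition pushout_exact X B D P (i : hom X B) (f : hom X D)
    (j : hom B P) (k : hom D P) :=
  forall Z (b : hom Z B) (d : hom Z D), j ∘ b = k ∘ d ->
    exists a : hom Z X, i ∘ a = b /\ f ∘ a = d.

(** The pushout is the cokernel of [phi], with components [i] and [- f]. Generation lifts elements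
    along the cokernel projection. If [i] is monic then so is [phi], which is then the kernel of its
    cokernel; this is exactness, with no cover required. *)
Lemma pushout_exists X B D (i : hom X B) (f : hom X D) :
  exists P (j : hom B P) (k : hom D P),
    [/\ is_pushout i f j k, pushout_generated j k
      & is_monic i -> pushout_exact i f j k].
Proof.
pose phi := in1 ∘ i - in2 ∘ f.
have pr1phi : pr1 ∘ phi = i.
  by rewrite /phi !(compE, biprodE) subr0.
have pr2phi : pr2 ∘ phi = - f.
  by rewrite /phi !(compE, biprodE) sub0r.
have [qphi qP] := coker_projP phi.
set q := coker_proj phi in qphi qP.
exists (cokernel phi), (q ∘ in1), (q ∘ in2); split; [split| |].
- by apply/eqP; rewrite -subr_eq0 -!comp_assoc -compmN -comp_addr qphi.
- move=> Q b c bicf; apply/unique_existsP; split.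
    have /qP[u [uq _]] : (b ∘ pr1 + c ∘ pr2) ∘ phi = 0.
      by rewrite comp_addl -!comp_assoc pr1phi pr2phi bicf compE subrr.
    exists u; rewrite !comp_assoc uq !compE -!comp_assoc.
    by rewrite !biprodE !compE addr0 add0r.
  move=> u v [ub uc] [vb vc]; apply: (@coker_proj_epic _ _ phi).
  rewrite -/q -(comp_idr q) -biprod_id !compE !comp_assoc.
  by rewrite !(comp_assoc _ q) in ub uc vb vc *; rewrite ub uc vb vc.
- move=> Z p; have [Z' [e [w [ee qw]]]] := epic_lift p (@coker_proj_epic _ _ phi).
  exists Z', e, (pr1 ∘ w), (pr2 ∘ w); split=> //; rewrite -qw -/q.
  by rewrite -{1}(comp_idl w) -biprod_id !compE -!comp_assoc.
- move=> im Z b d jbkd.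
  have phi_mono : is_monic phi.
    move=> W g h /(congr1 (cat_comp pr1)).
    by rewrite !comp_assoc pr1phi => /im.
  have [_ kP] := monic_kernel phi_mono (coker_projP phi).
  have /kP[a [phia _]] : q ∘ (in1 ∘ b - in2 ∘ d) = 0.
    by rewrite !compE !comp_assoc jbkd subrr.
  exists a; split; first rewrite -pr1phi -comp_assoc phia.
    by rewrite !(compE, biprodE) subr0.
  apply: oppr_inj; rewrite -compNm -pr2phi -comp_assoc phia.
  by rewrite !(compE, biprodE) sub0r.
Qed.

Lemma pushout_exact_monic X B D P (i : hom X B) (f : hom X D)
    (j : hom B P) (k : hom D P) :
  pushout_exact i f j k -> is_monic i -> is_monic k.
Proof.
move=> ex /is_monicP im; apply/is_monicP => Z d kd.
have [|a [ia <-]] := ex Z 0 d; first by rewrite compm0 kd.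
by rewrite (im _ _ ia) compm0.
Qed.

End Abelian.
Arguments in1 {A X Y}.
Arguments in2 {A X Y}.
Arguments pr1 {A X Y}.
Arguments pr2 {A X Y}.

(** * Homology *)

Section HomologyMaps.
Context {A : abelian_category}.
Implicit Types X Y : chain_complex A.

Lemma cycles_mapK X Y (f : chain_map X Y) n :
  ker_inc (diff_out Y n) ∘ cycles_map f n = f n ∘ ker_inc (diff_out X n).
Proof. exact: ker_liftK. Qed.

Lemma to_cyclesK X n : ker_inc (diff_out X n) ∘ to_cycles X n = diff_in X n.
Proof. exact: ker_liftK. Qed.

Lemma homology_mapK X Y (f : chain_map X Y) n :
  homology_map f n ∘ coker_proj (to_cycles X n) =
  coker_proj (to_cycles Y n) ∘ cycles_map f n.
Proof. exact: coker_descK. Qed.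

Lemma coker_proj0 (B D : A) (f : hom B D) : coker_proj f ∘ f = 0.
Proof. by case: (coker_projP f). Qed.

Lemma ker_inc0 (B D : A) (f : hom B D) : f ∘ ker_inc f = 0.
Proof. by case: (ker_incP f). Qed.

Lemma homology_map_id X n : homology_map (chain_id X) n = idm _.
Proof.
apply: (@coker_proj_epic _ _ _ (to_cycles X n)).
rewrite homology_mapK comp_idl -[RHS]comp_idr; congr (_ ∘ _).
by apply: ker_inc_monic; rewrite cycles_mapK comp_idl comp_idr.
Qed.

Lemma homology_map_comp X Y (Z : chain_complex A)
    (g : chain_map Y Z) (f : chain_map X Y) n :
  homology_map (chain_comp g f) n = homology_map g n ∘ homology_map f n.
Proof.
apply: (@coker_proj_epic _ _ _ (to_cycles X n)).
rewrite -comp_assoc !homology_mapK comp_assoc homology_mapK -comp_assoc.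
congr (_ ∘ _); apply: ker_inc_monic.
by rewrite cycles_mapK comp_assoc cycles_mapK -!comp_assoc cycles_mapK.
Qed.

(* A map [Z -> X n] is regarded as a local element of [X n], and an epic
   [Z' -> Z] as a cover over which equations are solved. *)
Definition homology_inj X Y (f : chain_map X Y) : Prop :=
  forall (i j k : int) (ij : i = j + 1) (jk : j = k + 1) (Z : A)
    (z : hom Z (X j)) (y : hom Z (Y i)),
  cc_diff X jk ∘ z = 0 -> f j ∘ z = cc_diff Y ij ∘ y ->
  exists Z' (e : hom Z' Z) (x : hom Z' (X i)),
    is_epic e /\ cc_diff X ij ∘ x = z ∘ e.

(** Degrees are arbitrary consecutive [i], [j], [k] rather than [n + 1], [n], [n - 1], so that
    diagram chases need no transports. *)
Definition homology_surj X Y (f : chain_map X Y) : Prop :=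
  forall (i j k : int) (ij : i = j + 1) (jk : j = k + 1) (Z : A)
    (y : hom Z (Y j)),
  cc_diff Y jk ∘ y = 0 ->
  exists Z' (e : hom Z' Z) (z : hom Z' (X j)) (w : hom Z' (Y i)),
    [/\ is_epic e, cc_diff X jk ∘ z = 0 & y ∘ e = f j ∘ z + cc_diff Y ij ∘ w].

(** The class of [z] dies in the homology of [Y], hence already in that of [X]; by [coker_exact],
    [z] is locally a boundary. *)
Lemma quasi_iso_homology_inj X Y (f : chain_map X Y) :
  quasi_iso (f : hom (X : Ch A) Y) -> homology_inj f.
Proof.
move=> fq i j k ij jk Z z y; have kE : j - 1 = k by rewrite jk addrK.
(* With [k] replaced by [j - 1] and [i] by [j + 1], the differentials become the [diff_out] and
   [diff_in] that define homology. *)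
case: _ / kE jk => jk.
subst i; rewrite (eq_irrelevance jk (esym (subrK 1 j))) => dz fz.
have [z' [z'E _]] := (ker_incP (diff_out X j)).2 _ _ dz.
have cmz : cycles_map f j ∘ z' = to_cycles Y j ∘ y.
  apply: ker_inc_monic.
  by rewrite comp_assoc cycles_mapK -comp_assoc z'E fz comp_assoc to_cyclesK.
have /coker_exact[Z' [e [x [e_epi xE]]]] : coker_proj (to_cycles X j) ∘ z' = 0.
  have [g [gH _]] := fq j.
  rewrite -(comp_idl (_ ∘ z')) -gH -!comp_assoc (comp_assoc _ _ z').
  by rewrite homology_mapK -comp_assoc cmz (comp_assoc _ _ y) coker_proj0 !compE.
exists Z', e, x; split=> //.
by rewrite -[cc_diff X _]to_cyclesK -comp_assoc xE comp_assoc z'E.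
Qed.

(** The inverse on homology sends the class of [y] to a class represented locally by a cycle; [y]
    minus the image of that cycle has class zero, so it is locally a boundary. *)
Lemma quasi_iso_homology_surj X Y (f : chain_map X Y) :
  quasi_iso (f : hom (X : Ch A) Y) -> homology_surj f.
Proof.
move=> fq i j k ij jk Z y; have kE : j - 1 = k by rewrite jk addrK.
case: _ / kE jk => jk.
subst i; rewrite (eq_irrelevance jk (esym (subrK 1 j))) => dy.
have [y' [y'E _]] := (ker_incP (diff_out Y j)).2 _ _ dy.
have [g [_ Hg]] := fq j.
have [Z1 [e1 [z [e1_epi zE]]]] :=
  epic_lift (g ∘ (coker_proj (to_cycles Y j) ∘ y'))
            (@coker_proj_epic _ _ _ (to_cycles X j)).
have /coker_exact[Z2 [e2 [w [e2_epi wE]]]] :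
    coker_proj (to_cycles Y j) ∘ (y' ∘ e1 - cycles_map f j ∘ z) = 0.
  rewrite compE compmN (comp_assoc _ (cycles_map f j)) -homology_mapK.
  rewrite -(comp_assoc (homology_map f j)) zE !comp_assoc Hg comp_idl.
  by rewrite subrr.
exists Z2, (e1 ∘ e2), (ker_inc (diff_out X j) ∘ (z ∘ e2)), w; split.
- exact: is_epic_comp.
- by rewrite comp_assoc ker_inc0 comp0m.
rewrite -[cc_diff Y _]to_cyclesK -y'E (comp_assoc (f j)) -cycles_mapK.
rewrite -!comp_assoc wE -comp_addr; congr (_ ∘ _).
by rewrite comp_addl compNm -!comp_assoc [RHS]addrC subrK.
Qed.

Lemma homology_inj_surj_quasi_iso X Y (f : chain_map X Y) :
  homology_inj f -> homology_surj f -> quasi_iso (f : hom (X : Ch A) Y).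
Proof.
move=> f_inj f_surj n; apply: monic_epic_iso.
  apply/is_monicP => Z u Hu.
  have [Z1 [e1 [z [e1_epi zE]]]] :=
    epic_lift u (@coker_proj_epic _ _ _ (to_cycles X n)).
  have /coker_exact[Z2 [e2 [y [e2_epi yE]]]] :
      coker_proj (to_cycles Y n) ∘ (cycles_map f n ∘ z) = 0.
    by rewrite comp_assoc -homology_mapK -comp_assoc zE comp_assoc Hu comp0m.
  have dz : diff_out X n ∘ (ker_inc (diff_out X n) ∘ (z ∘ e2)) = 0.
    by rewrite comp_assoc ker_inc0 comp0m.
  have fz : f n ∘ (ker_inc (diff_out X n) ∘ (z ∘ e2)) = diff_in Y n ∘ y.
    by rewrite comp_assoc -cycles_mapK -to_cyclesK -!comp_assoc yE -comp_assoc.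
  have [Z3 [e3 [x [e3_epi xE]]]] := f_inj _ _ _ _ _ _ _ _ dz fz.
  have {}xE : to_cycles X n ∘ x = z ∘ e2 ∘ e3.
    by apply: ker_inc_monic; rewrite !comp_assoc to_cyclesK [LHS]xE !comp_assoc.
  apply: e1_epi; apply: e2_epi; apply: e3_epi.
  by rewrite -zE -2!comp_assoc (comp_assoc z) -xE comp_assoc coker_proj0 !comp0m.
apply/is_epicP => Z v vH; apply: (@coker_proj_epic _ _ _ (to_cycles Y n)).
(* Surjectivity is applied to the universal cycle, the inclusion of [cycles Y n]. Its cover [e] is
   then a sum of an image of cycles of [X] and a boundary, both killed by [v] after projection to
   homology. *)
have [Z1 [e [z [w [e_epi dz yE]]]]] :=
  f_surj _ _ _ erefl (esym (subrK 1 n)) _ _ (ker_inc0 (diff_out Y n)).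
have [z' [z'E _]] := (ker_incP (diff_out X n)).2 _ _ dz.
have {}yE : e = cycles_map f n ∘ z' + to_cycles Y n ∘ w.
  apply: ker_inc_monic; rewrite [LHS]yE comp_addr comp_assoc cycles_mapK.
  by rewrite -comp_assoc z'E comp_assoc to_cyclesK.
rewrite comp0m; apply: e_epi; rewrite comp0m {1}yE.
rewrite comp_addr -!(comp_assoc v) !(comp_assoc (coker_proj _)) coker_proj0.
by rewrite -homology_mapK !comp_assoc vH !compE addr0.
Qed.

Lemma quasi_isoP X Y (f : chain_map X Y) :
  quasi_iso (f : hom (X : Ch A) Y) <-> homology_inj f /\ homology_surj f.
Proof.
split=> [fq|[]]; last exact: homology_inj_surj_quasi_iso.
by split; [apply: quasi_iso_homology_inj|apply: quasi_iso_homology_surj].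
Qed.

Lemma quasi_iso_2of3 X Y (Z : chain_complex A)
    (g : hom (Y : Ch A) Z) (f : hom (X : Ch A) Y) :
  [/\ quasi_iso f -> quasi_iso g -> quasi_iso (g ∘ f),
      quasi_iso f -> quasi_iso (g ∘ f) -> quasi_iso g
    & quasi_iso g -> quasi_iso (g ∘ f) -> quasi_iso f].
Proof.
have H n := is_iso_2of3 (homology_map g n) (homology_map f n).
split=> h1 h2 n; case: (H n); rewrite -?homology_map_comp.
- by move=> + _ _; apply; [apply: h1|apply: h2].
- by move=> _ + _; apply; [apply: h1|apply: h2].
- by move=> _ _; apply; [apply: h1|apply: h2].
Qed.

Lemma is_iso_quasi_iso X Y (f : hom (X : Ch A) Y) : is_iso f -> quasi_iso f.
Proof.
move=> [g [gf fg]] n; exists (homology_map g n).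
rewrite -!homology_map_comp; split; rewrite -homology_map_id.
  by congr (homology_map _ n).
by congr (homology_map _ n).
Qed.

End HomologyMaps.

(** * Complexes *)

Section Complexes.
Context {A : abelian_category}.
Implicit Types X Y B D P : chain_complex A.

Lemma cm_commK X Y (f : chain_map X Y) (i j : int) (ij : i = j + 1)
    (Z : A) (u : hom Z (X i)) :
  f j ∘ (cc_diff X ij ∘ u) = cc_diff Y ij ∘ (f i ∘ u).
Proof. by rewrite comp_assoc cm_comm -comp_assoc. Qed.

Lemma diff_diffK X (i j k : int) (ij : i = j + 1) (jk : j = k + 1)
    (Z : A) (u : hom Z (X i)) :
  cc_diff X jk ∘ (cc_diff X ij ∘ u) = 0.
Proof. by rewrite comp_assoc diff_diff comp0m. Qed.

Lemma pullback_jointly_monic (B D E P : A) (p : hom B E) (f : hom D E)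
    (j : hom P B) (k : hom P D) (Z : A) (u v : hom Z P) :
  is_pullback p f j k -> j ∘ u = j ∘ v -> k ∘ u = k ∘ v -> u = v.
Proof.
move=> [pj UP] ju kv.
have /UP/unique_existsP[_ U] : p ∘ (j ∘ v) = f ∘ (k ∘ v) by rewrite !comp_assoc pj.
exact: U.
Qed.

Lemma pushout_jointly_epic (B D E P : A) (p : hom E B) (f : hom E D)
    (j : hom B P) (k : hom D P) (Z : A) (u v : hom P Z) :
  is_pushout p f j k -> u ∘ j = v ∘ j -> u ∘ k = v ∘ k -> u = v.
Proof.
move=> [pj UP] ju kv.
have /UP/unique_existsP[_ U] : v ∘ j ∘ p = v ∘ k ∘ f by rewrite -!comp_assoc pj.
exact: U.
Qed.

(** * Stability of monic quasi-isomorphisms under pushout *)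

Section TrivialPushout.
Variables (X B D P : chain_complex A) (m : chain_map X B) (f : chain_map X D).
Variables (b : chain_map B P) (d : chain_map D P).
Hypothesis m_mono : forall n, is_monic (m n).
Hypothesis b_m : forall n, b n ∘ m n = d n ∘ f n.
Hypothesis gen : forall n, pushout_generated (b n) (d n).
Hypothesis exact : forall n, pushout_exact (m n) (f n) (b n) (d n).

Lemma pushout_squareK n (Z : A) (u : hom Z (X n)) : b n ∘ (m n ∘ u) = d n ∘ (f n ∘ u).
Proof. by rewrite !comp_assoc b_m. Qed.

(** Locally write an element of [P] as [b y1 + d y2]. Exactness turns the resulting relation between
    boundaries into an element [a] of [X] with [m a] the boundary of [y1]. As [m] is injective on
    homology, [a] is locally a boundary, and this corrects [y2] for injectivity of [d], or [y1] to a
    cycle for surjectivity. *)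
Lemma pushout_quasi_iso :
  quasi_iso (m : hom (X : Ch A) B) -> quasi_iso (d : hom (D : Ch A) P).
Proof.
move=> /quasi_isoP[m_inj m_surj]; apply/quasi_isoP.
(* Monicity of [m] in degree [k] reflects cycles, in particular for elements whose image is a
   boundary. *)
have lift_cycle (i j k : int) (ij : i = j + 1) (jk : j = k + 1) (Z : A)
    (x : hom Z (X j)) (y : hom Z (B i)) :
    m j ∘ x = cc_diff B ij ∘ y -> cc_diff X jk ∘ x = 0.
  by move=> mx; apply: (m_mono (n := k)); rewrite cm_commK mx diff_diffK compm0.
split=> [i j k ij jk Z z y dz kz|i j k ij jk Z y dy].
  have [Z1 [e1 [y1 [y2 [e1_epi yE]]]]] := gen y.
  have /exact[a [ma fa]] :
      b j ∘ (cc_diff B ij ∘ y1) = d j ∘ (z ∘ e1 - cc_diff D ij ∘ y2).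
    rewrite comp_addr compmN (comp_assoc (d j)) kz -comp_assoc yE comp_addr.
    by rewrite !cm_commK addrK.
  have [Z2 [e2 [x [e2_epi dx]]]] :=
    m_inj _ _ _ _ _ _ _ _ (lift_cycle _ _ _ ij jk _ _ _ ma) ma.
  exists Z2, (e1 ∘ e2), (y2 ∘ e2 + f i ∘ x); split; first exact: is_epic_comp.
  rewrite comp_addr -cm_commK dx (comp_assoc (f j)) fa comp_addl compNm.
  by rewrite -!comp_assoc addrC subrK.
have [Z1 [e1 [y1 [y2 [e1_epi yE]]]]] := gen y.
have /exact[a [ma fa]] :
    b k ∘ (cc_diff B jk ∘ y1) = d k ∘ (- (cc_diff D jk ∘ y2)).
  apply/eqP; rewrite compmN -addr_eq0 !cm_commK -comp_addr -yE comp_assoc dy.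
  by rewrite comp0m.
(* Here [a] lives in degree [k], so injectivity on homology involves the degree below it. *)
have kl : k = k - 1 + 1 by rewrite subrK.
have [Z2 [e2 [a1 [e2_epi da1]]]] :=
  m_inj _ _ _ _ _ _ _ _ (lift_cycle _ _ _ jk kl _ _ _ ma) ma.
have [|Z3 [e3 [a2 [b2 [e3_epi da2 a2E]]]]] :=
    m_surj _ _ _ ij jk _ (y1 ∘ e2 - m j ∘ a1).
  rewrite comp_addr compmN -cm_commK da1 !comp_assoc ma.
  by rewrite subrr.
exists Z3, (e1 ∘ (e2 ∘ e3)), (f j ∘ a2 + (f j ∘ a1 + y2 ∘ e2) ∘ e3), (b i ∘ b2).
split; first by do 2?apply: is_epic_comp.
  rewrite comp_addr -cm_commK da2 compm0 add0r comp_assoc comp_addr.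
  rewrite -cm_commK da1 (comp_assoc (f k)) fa comp_assoc compNm -addrC.
  by rewrite subrr comp0m.
rewrite comp_assoc yE comp_addl.
have -> : b j ∘ y1 ∘ (e2 ∘ e3) =
    d j ∘ (f j ∘ a2) + cc_diff P ij ∘ (b i ∘ b2) + d j ∘ (f j ∘ (a1 ∘ e3)).
  rewrite -!pushout_squareK -cm_commK -!comp_addr -a2E comp_addl compNm -!comp_assoc.
  by rewrite subrK.
rewrite !comp_addr comp_addl comp_addr -!comp_assoc -!addrA; congr (_ + _).
by rewrite addrC addrA.
Qed.

End TrivialPushout.

(** * Stability of epic quasi-isomorphisms under pullback *)

Section TrivialPullback.
Variables (X B D P : chain_complex A) (p : chain_map B D) (f : chain_map X D).
Variables (b : chain_map P B) (x : chain_map P X).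
Hypothesis p_epi : forall n, is_epic (p n).
Hypothesis pb : forall n, is_pullback (p n) (f n) (b n) (x n).

(** Elements of [P] are pairs over [D]. The homology of [p] supplies a first component up to an
    error in [D], which is removed by lifting along the degreewise epic [p]. *)
Lemma pullback_quasi_iso :
  quasi_iso (p : hom (B : Ch A) D) -> quasi_iso (x : hom (P : Ch A) X).
Proof.
move=> /quasi_isoP[p_inj p_surj]; apply/quasi_isoP.
have p_b n (Z : A) (u : hom Z (P n)) : p n ∘ (b n ∘ u) = f n ∘ (x n ∘ u).
  by rewrite !comp_assoc (pb n).1.
split=> [i j k ij jk Z z y dz xz|i j k ij jk Z y dy].
  have [||Z1 [e1 [b1 [e1_epi b1E]]]] :=
      p_inj _ _ _ ij jk _ (b j ∘ z) (f i ∘ y).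
  - by rewrite -cm_commK dz compm0.
  - by rewrite p_b xz cm_commK.
  (* [p b1] and [f y] have the same boundary, so their difference is a cycle; surjectivity on
     homology makes it [p b2] plus the boundary of some [w] in degree [i + 1]. Subtracting [b2] and
     the boundary of a lift of [w] from [b1] gives [b4] lying over [f y]. *)
  have hi : i + 1 = i + 1 by [].
  have [|Z2 [e2 [b2 [w [e2_epi db2 b2E]]]]] :=
      p_surj _ _ _ hi ij _ (p i ∘ b1 - f i ∘ (y ∘ e1)).
    rewrite comp_addr compmN -!cm_commK b1E -comp_assoc p_b (comp_assoc (x j)) xz.
    by rewrite -comp_assoc subrr.
  have [Z3 [e3 [b3 [e3_epi b3E]]]] := epic_lift w (p_epi (n := i + 1)).
  pose b4 := (b1 ∘ e2 - b2) ∘ e3 - cc_diff B hi ∘ b3.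
  have /(pb i).2[u [[bu xu] _]] : p i ∘ b4 = f i ∘ (y ∘ (e1 ∘ (e2 ∘ e3))).
    rewrite /b4 comp_addr compmN cm_commK b3E comp_assoc comp_addr compmN.
    have -> : p i ∘ (b1 ∘ e2) = f i ∘ (y ∘ (e1 ∘ e2)) + cc_diff D hi ∘ w
        + p i ∘ b2.
      rewrite -addrA [_ + p i ∘ _]addrC -b2E comp_addl compNm -!comp_assoc.
      by rewrite addrC subrK.
    by rewrite addrK comp_addl -!comp_assoc addrK.
  exists Z3, (e1 ∘ (e2 ∘ e3)), u; split; first by do 2?apply: is_epic_comp.
  apply: pullback_jointly_monic (pb j) _ _.
    rewrite cm_commK bu /b4 comp_addr compmN diff_diffK subr0 comp_assoc.
    rewrite comp_addr compmN db2 subr0 comp_assoc b1E -!comp_assoc.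
    by [].
  by rewrite cm_commK xu !comp_assoc xz.
have [|Z1 [e1 [b1 [w [e1_epi db1 b1E]]]]] := p_surj _ _ _ ij jk _ (f j ∘ y).
  by rewrite -cm_commK dy compm0.
have [Z2 [e2 [b2 [e2_epi b2E]]]] := epic_lift w (p_epi (n := i)).
(* Adding the boundary of a lift of [w] keeps [b1] a cycle and makes it match [f y] exactly. *)
have /(pb j).2[u [[bu xu] _]] :
    p j ∘ (b1 ∘ e2 + cc_diff B ij ∘ b2) = f j ∘ (y ∘ (e1 ∘ e2)).
  rewrite comp_addr cm_commK b2E !comp_assoc -comp_addl.
  by rewrite -b1E.
exists Z2, (e1 ∘ e2), u, 0; split; first exact: is_epic_comp.
  apply: pullback_jointly_monic (pb k) _ _; rewrite compm0 cm_commK.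
    by rewrite bu comp_addr diff_diffK comp_assoc db1 comp0m addr0.
  by rewrite xu comp_assoc dy comp0m.
by rewrite xu compm0 addr0.
Qed.

End TrivialPullback.
End Complexes.

(** * Degreewise pushouts and pullbacks of complexes *)

Section PushoutComplexes.
Context {A : abelian_category}.
Implicit Types X B D P : chain_complex A.

(** The degreewise induced maps commute with differentials because the legs of each pushout are
    jointly epic. *)
Lemma pushout_chain X B D P (m : chain_map X B) (f : chain_map X D)
    (b : chain_map B P) (d : chain_map D P) :
  (forall n, is_pushout (m n) (f n) (b n) (d n)) ->
  is_pushout (m : hom (X : Ch A) B) f b (d : hom (D : Ch A) P).
Proof.
move=> po; split; first by apply: chain_map_ext => n; apply: (po n).1.
move=> Q u v uv; have uvn n : u n ∘ m n = v n ∘ f n.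
  exact: (congr1 (fun h : chain_map X Q => h n) uv).
have [w wP] : exists w : forall n, hom (P n) (Q n),
    forall n, w n ∘ b n = u n /\ w n ∘ d n = v n.
  have wex n : exists w : hom (P n) (Q n), w ∘ b n = u n /\ w ∘ d n = v n.
    by have [w [wP _]] := (po n).2 _ _ _ (uvn n); exists w.
  by exists (fun n => sval (cid (wex n))) => n; apply: (svalP (cid (wex n))).
have w_comm (i j : int) (ij : i = j + 1) :
    w j ∘ cc_diff P ij = cc_diff Q ij ∘ w i.
  have [wbi wdi] := wP i; have [wbj wdj] := wP j.
  apply: pushout_jointly_epic (po i) _ _; rewrite -!comp_assoc -cm_comm.
    by rewrite wbi comp_assoc wbj cm_comm.
  by rewrite wdi comp_assoc wdj cm_comm.
apply/unique_existsP; split.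
  by exists (ChainMap w_comm); split; apply: chain_map_ext => n; case: (wP n).
move=> g h [gb gd] [hb hd]; apply: chain_map_ext => n.
apply: pushout_jointly_epic (po n) _ _.
  exact: (congr1 (fun h : chain_map B Q => h n) (etrans gb (esym hb))).
exact: (congr1 (fun h : chain_map D Q => h n) (etrans gd (esym hd))).
Qed.

Lemma pullback_chain X B D P (m : chain_map B X) (f : chain_map D X)
    (b : chain_map P B) (d : chain_map P D) :
  (forall n, is_pullback (m n) (f n) (b n) (d n)) ->
  is_pullback (m : hom (B : Ch A) X) f b (d : hom (P : Ch A) D).
Proof.
move=> pb; split; first by apply: chain_map_ext => n; apply: (pb n).1.
move=> Q u v uv; have uvn n : m n ∘ u n = f n ∘ v n.
  exact: (congr1 (fun h : chain_map Q X => h n) uv).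
have [w wP] : exists w : forall n, hom (Q n) (P n),
    forall n, b n ∘ w n = u n /\ d n ∘ w n = v n.
  have wex n : exists w : hom (Q n) (P n), b n ∘ w = u n /\ d n ∘ w = v n.
    by have [w [wP _]] := (pb n).2 _ _ _ (uvn n); exists w.
  by exists (fun n => sval (cid (wex n))) => n; apply: (svalP (cid (wex n))).
have w_comm (i j : int) (ij : i = j + 1) :
    w j ∘ cc_diff Q ij = cc_diff P ij ∘ w i.
  have [wbi wdi] := wP i; have [wbj wdj] := wP j.
  apply: pullback_jointly_monic (pb j) _ _; rewrite cm_commK comp_assoc.
    by rewrite wbi wbj cm_comm.
  by rewrite wdi wdj cm_comm.
apply/unique_existsP; split.
  by exists (ChainMap w_comm); split; apply: chain_map_ext => n; case: (wP n).
move=> g h [gb gd] [hb hd]; apply: chain_map_ext => n.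
apply: pullback_jointly_monic (pb n) _ _.
  exact: (congr1 (fun h : chain_map Q B => h n) (etrans gb (esym hb))).
exact: (congr1 (fun h : chain_map Q D => h n) (etrans gd (esym hd))).
Qed.

(** The differential is induced by the universal property in each degree and squares to zero since
    it does so on both legs. *)
Lemma pushout_complex_exists X B D (m : chain_map X B) (f : chain_map X D) :
  exists P (b : chain_map B P) (d : chain_map D P), forall n,
    [/\ is_pushout (m n) (f n) (b n) (d n), pushout_generated (b n) (d n)
      & is_monic (m n) -> pushout_exact (m n) (f n) (b n) (d n)].
Proof.
have tex n : exists t : {P : A & (hom (B n) P * hom (D n) P)%type},
    [/\ is_pushout (m n) (f n) (projT2 t).1 (projT2 t).2,
        pushout_generated (projT2 t).1 (projT2 t).2
      & is_monic (m n) ->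
        pushout_exact (m n) (f n) (projT2 t).1 (projT2 t).2].
  have [P [b [d h]]] := pushout_exists (m n) (f n).
  by exists (existT _ P (b, d)).
pose P n : A := projT1 (sval (cid (tex n))).
pose b n : hom (B n) (P n) := (projT2 (sval (cid (tex n)))).1.
pose d n : hom (D n) (P n) := (projT2 (sval (cid (tex n)))).2.
have poP n : [/\ is_pushout (m n) (f n) (b n) (d n), pushout_generated (b n) (d n)
      & is_monic (m n) -> pushout_exact (m n) (f n) (b n) (d n)].
  exact: svalP (cid (tex n)).
have po n : is_pushout (m n) (f n) (b n) (d n) by case: (poP n).
clearbody P b d; clear tex.
have dex (i j : int) (ij : i = j + 1) : exists u : hom (P i) (P j),
    u ∘ b i = b j ∘ cc_diff B ij /\ u ∘ d i = d j ∘ cc_diff D ij.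
  have [|u [uP _]] := (po i).2 _ (b j ∘ cc_diff B ij) (d j ∘ cc_diff D ij).
    by rewrite -!comp_assoc -!cm_comm !comp_assoc (po j).1.
  by exists u.
pose dP (i j : int) (ij : i = j + 1) := sval (cid (dex _ _ ij)).
have [dPb dPd] : (forall i j ij, @dP i j ij ∘ b i = b j ∘ cc_diff B ij) /\
    (forall i j ij, @dP i j ij ∘ d i = d j ∘ cc_diff D ij).
  by split=> i j ij; case: (svalP (cid (dex _ _ ij))).
have dPdP (i j k : int) (ij : i = j + 1) (jk : j = k + 1) :
    dP _ _ jk ∘ dP _ _ ij = 0.
  apply: pushout_jointly_epic (po i) _ _; rewrite -comp_assoc comp0m.
    by rewrite dPb comp_assoc dPb -comp_assoc diff_diff compm0.
  by rewrite dPd comp_assoc dPd -comp_assoc diff_diff compm0.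
pose Pc := ChainComplex dPdP.
exists Pc, (@ChainMap _ B Pc b (fun i j ij => esym (dPb i j ij))),
  (@ChainMap _ D Pc d (fun i j ij => esym (dPd i j ij))).
exact: poP.
Qed.

Lemma pullback_complex_exists X B D (m : chain_map B X) (f : chain_map D X) :
  exists P (b : chain_map P B) (d : chain_map P D), forall n,
    is_pullback (m n) (f n) (b n) (d n).
Proof.
have tex n : exists t : {P : A & (hom P (B n) * hom P (D n))%type},
    is_pullback (m n) (f n) (projT2 t).1 (projT2 t).2.
  have [P [b [d h]]] := pullback_exists (m n) (f n).
  by exists (existT _ P (b, d)).
pose P n : A := projT1 (sval (cid (tex n))).
pose b n : hom (P n) (B n) := (projT2 (sval (cid (tex n)))).1.
pose d n : hom (P n) (D n) := (projT2 (sval (cid (tex n)))).2.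
have pb n : is_pullback (m n) (f n) (b n) (d n) by apply: svalP (cid (tex n)).
clearbody P b d; clear tex.
have dex (i j : int) (ij : i = j + 1) : exists u : hom (P i) (P j),
    b j ∘ u = cc_diff B ij ∘ b i /\ d j ∘ u = cc_diff D ij ∘ d i.
  have [|u [uP _]] := (pb j).2 _ (cc_diff B ij ∘ b i) (cc_diff D ij ∘ d i).
    by rewrite !cm_commK (pb i).1.
  by exists u.
pose dP (i j : int) (ij : i = j + 1) := sval (cid (dex _ _ ij)).
have [dPb dPd] : (forall i j ij, b j ∘ @dP i j ij = cc_diff B ij ∘ b i) /\
    (forall i j ij, d j ∘ @dP i j ij = cc_diff D ij ∘ d i).
  by split=> i j ij; case: (svalP (cid (dex _ _ ij))).
have dPdP (i j k : int) (ij : i = j + 1) (jk : j = k + 1) :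
    dP _ _ jk ∘ dP _ _ ij = 0.
  apply: pullback_jointly_monic (pb k) _ _; rewrite comp_assoc compm0.
    by rewrite dPb -comp_assoc dPb diff_diffK.
  by rewrite dPd -comp_assoc dPd diff_diffK.
pose Pc := ChainComplex dPdP.
by exists Pc, (@ChainMap _ Pc B b dPb), (@ChainMap _ Pc D d dPd).
Qed.

End PushoutComplexes.

(** * Sums, contractible complexes and the two factorizations *)

Section Factorizations.
Context {A : abelian_category}.
Implicit Types X Y K : chain_complex A.

Lemma zero_complex_exists : exists O : Ch A, is_zero O /\ forall n, is_zero (O n).
Proof.
have [Z Z0] := ab_zero A.
have dd (i j k : int) (ij : i = j + 1) (jk : j = k + 1) :
  (0 : hom Z Z) ∘ (0 : hom Z Z) = 0 by rewrite comp0m.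
pose O : chain_complex A := @ChainComplex _ (fun=> Z) (fun _ _ _ => 0) dd.
exists O; split=> //; split=> X.
  have comm (i j : int) (ij : i = j + 1) :
    (0 : hom (O j) (X j)) ∘ cc_diff O ij = cc_diff X ij ∘ 0 by rewrite comp0m compm0.
  exists (ChainMap comm); split=> // f _; apply: chain_map_ext => n.
  by rewrite [RHS](zero_source _ Z0).
have comm (i j : int) (ij : i = j + 1) :
  (0 : hom (X j) (O j)) ∘ cc_diff X ij = cc_diff O ij ∘ 0 by rewrite comp0m compm0.
exists (ChainMap comm); split=> // f _; apply: chain_map_ext => n.
by rewrite [RHS](zero_target _ Z0).
Qed.

Lemma sum_diff_diff X Y (i j k : int) (ij : i = j + 1) (jk : j = k + 1) :
  (in1 ∘ cc_diff X jk ∘ pr1 + in2 ∘ cc_diff Y jk ∘ pr2) ∘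
  (in1 ∘ cc_diff X ij ∘ pr1 + in2 ∘ cc_diff Y ij ∘ pr2) = 0.
Proof.
rewrite !compE -!comp_assoc !biprodE !diff_diffK !(compE, biprodE).
by rewrite !addr0.
Qed.

Definition sum_complex X Y : chain_complex A :=
  ChainComplex (@sum_diff_diff X Y).

Lemma sum_in1_comm X Y (i j : int) (ij : i = j + 1) :
  in1 ∘ cc_diff X ij = cc_diff (sum_complex X Y) ij ∘ in1.
Proof. by rewrite !compE -!comp_assoc !biprodE !compE addr0. Qed.

Definition sum_in1 X Y : chain_map X (sum_complex X Y) :=
  @ChainMap _ X (sum_complex X Y) (fun=> in1) (@sum_in1_comm X Y).

Lemma sum_in2_comm X Y (i j : int) (ij : i = j + 1) :
  in2 ∘ cc_diff Y ij = cc_diff (sum_complex X Y) ij ∘ in2.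
Proof. by rewrite !compE -!comp_assoc !biprodE !compE add0r. Qed.

Lemma sum_pr1_comm X Y (i j : int) (ij : i = j + 1) :
  pr1 ∘ cc_diff (sum_complex X Y) ij = cc_diff X ij ∘ pr1.
Proof. by rewrite !compE -!comp_assoc !biprodE addr0. Qed.

Definition sum_pr1 X Y : chain_map (sum_complex X Y) X :=
  @ChainMap _ (sum_complex X Y) X (fun=> pr1) (@sum_pr1_comm X Y).

Lemma sum_pr2_comm X Y (i j : int) (ij : i = j + 1) :
  pr2 ∘ cc_diff (sum_complex X Y) ij = cc_diff Y ij ∘ pr2.
Proof. by rewrite !compE -!comp_assoc !biprodE add0r. Qed.

Lemma sum_pair_comm X Y Z (f : chain_map Z X) (g : chain_map Z Y)
    (i j : int) (ij : i = j + 1) :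
  (in1 ∘ f j + in2 ∘ g j) ∘ cc_diff Z ij =
  cc_diff (sum_complex X Y) ij ∘ (in1 ∘ f i + in2 ∘ g i).
Proof.
rewrite comp_addr !comp_assoc -sum_in1_comm -sum_in2_comm comp_addl.
by rewrite -!comp_assoc !cm_comm.
Qed.

Lemma sum_copair_comm X Y Z (f : chain_map X Z) (g : chain_map Y Z)
    (i j : int) (ij : i = j + 1) :
  (f j ∘ pr1 + g j ∘ pr2) ∘ cc_diff (sum_complex X Y) ij =
  cc_diff Z ij ∘ (f i ∘ pr1 + g i ∘ pr2).
Proof.
rewrite comp_addl comp_addr -!comp_assoc sum_pr1_comm sum_pr2_comm.
by rewrite !cm_commK.
Qed.

Definition sum_pair X Y Z (f : chain_map Z X) (g : chain_map Z Y) :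
  chain_map Z (sum_complex X Y) :=
  @ChainMap _ _ (sum_complex X Y) _ (sum_pair_comm f g).

Definition sum_copair X Y Z (f : chain_map X Z) (g : chain_map Y Z) :
  chain_map (sum_complex X Y) Z :=
  @ChainMap _ (sum_complex X Y) _ _ (sum_copair_comm f g).

(** Acyclicity in a strong form: cycles bound without passing to a cover, as in a contractible
    complex. *)
Definition cycles_bound K : Prop :=
  forall (i j k : int) (ij : i = j + 1) (jk : j = k + 1) (Z : A)
    (z : hom Z (K j)),
  cc_diff K jk ∘ z = 0 -> exists x, cc_diff K ij ∘ x = z.

Lemma sum_pr1_quasi_iso X K :
  cycles_bound K -> quasi_iso (sum_pr1 X K : hom (sum_complex X K : Ch A) X).
Proof.
move=> K_acyclic; apply/quasi_isoP; split=> i j k ij jk Z.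
  move=> z y dz zE; have [|x xE] := K_acyclic _ _ _ ij jk _ (pr2 ∘ z).
    by rewrite comp_assoc -sum_pr2_comm -comp_assoc dz compm0.
  exists Z, (idm Z), (in1 ∘ y + in2 ∘ x); split; first exact: is_epic_idm.
  rewrite comp_addr !comp_assoc -sum_in1_comm -sum_in2_comm -!comp_assoc.
  by rewrite xE -zE comp_idr /= !comp_assoc -comp_addl biprod_id comp_idl.
move=> y dy; exists Z, (idm Z), (in1 ∘ y), 0; split; first exact: is_epic_idm.
  by rewrite comp_assoc -sum_in1_comm -comp_assoc dy compm0.
by rewrite /= biprodE !compE addr0.
Qed.

(** A section of the quasi-isomorphism [sum_pr1], by two out of three. *)
Lemma sum_in1_quasi_iso X K :
  cycles_bound K -> quasi_iso (sum_in1 X K : hom (X : Ch A) (sum_complex X K)).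
Proof.
move=> /(@sum_pr1_quasi_iso X) prq.
case: (quasi_iso_2of3 (sum_pr1 X K : hom (sum_complex X K : Ch A) X)
   (sum_in1 X K : hom (X : Ch A) (sum_complex X K))) => _ _; apply=> //.
apply: is_iso_quasi_iso; exists (chain_id X).
by split; apply: chain_map_ext => n /=; rewrite biprodE !compE.
Qed.

(** The complex [disks] involves [G (i - 1)], and [i = j + 1] identifies [i - 1] with [j] only
    propositionally. *)
Definition transport (G : int -> A) (i j : int) (e : i = j) : hom (G i) (G j) :=
  match e with erefl => idm (G i) end.

Lemma transportK G i j (e : i = j) (e' : j = i) :
  transport G e ∘ transport G e' = idm _.
Proof. by case: _ / e e' => e'; rewrite (eq_irrelevance e' erefl) comp_idl. Qed.

Lemma diff_transport X i i' j (e : i' = i) (ij : i = j + 1) (ij' : i' = j + 1) :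
  cc_diff X ij ∘ transport X e = cc_diff X ij'.
Proof. by case: _ / e ij => ij; rewrite (eq_irrelevance ij ij') comp_idr. Qed.

Lemma transport_diff X i j j' (e : j = j') (ij : i = j + 1) (ij' : i = j' + 1) :
  transport X e ∘ cc_diff X ij = cc_diff X ij'.
Proof. by case: _ / e ij' => ij'; rewrite (eq_irrelevance ij ij') comp_idl. Qed.

Lemma transport_shift (G : int -> A) i j (e : i = j) (e' : i + 1 = j + 1) :
  transport (fun n => G (n + 1)) e = transport G e'.
Proof. by case: _ / e e' => e'; rewrite (eq_irrelevance e' erefl). Qed.

Lemma pred_eq (i j : int) : i = j + 1 -> i - 1 = j.
Proof. by move=> ->; rewrite addrK. Qed.

Definition disks_diff (G : int -> A) (i j : int) (ij : i = j + 1) :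
  hom (biprod (G i) (G (i - 1))) (biprod (G j) (G (j - 1))) :=
  in1 ∘ transport G (pred_eq ij) ∘ pr2.

Lemma disks_diff_diff (G : int -> A) (i j k : int)
    (ij : i = j + 1) (jk : j = k + 1) :
  disks_diff G jk ∘ disks_diff G ij = 0.
Proof. by rewrite /disks_diff -!comp_assoc biprodE !compE. Qed.

(* The sum over [n] of the contractible complexes given by the identity of
   [G n] placed in degrees [n + 1] and [n]. *)
Definition disks (G : int -> A) : chain_complex A :=
  ChainComplex (@disks_diff_diff G).

(** The differential of [(x, y)] is [(y, 0)], so a cycle has the form [(x, 0)] and bounds
    [(0, x)]. *)
Lemma disks_cycles_bound (G : int -> A) : cycles_bound (disks G).
Proof.
move=> i j k ij jk Z z; rewrite /= /disks_diff => dz.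
exists (in2 ∘ (transport G (esym (pred_eq ij)) ∘ (pr1 ∘ z))).
rewrite -!comp_assoc biprodE (comp_assoc (transport _ _)) transportK comp_idl.
rewrite -[RHS]comp_idl -biprod_id comp_addl -!comp_assoc.
suff -> : pr2 ∘ z = 0 by rewrite !compE addr0.
have tz : transport G (pred_eq jk) ∘ (pr2 ∘ z) = 0.
  by have := congr1 (cat_comp pr1) dz; rewrite -!comp_assoc biprodE compm0.
rewrite -[LHS]comp_idl -(transportK G (esym (pred_eq jk)) (pred_eq jk)).
by rewrite -comp_assoc tz compm0.
Qed.

Lemma to_disks_comm X (i j : int) (ij : i = j + 1) :
  (in1 + in2 ∘ diff_out X j) ∘ cc_diff X ij =
  cc_diff (disks X) ij ∘ (in1 + in2 ∘ diff_out X i).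
Proof.
rewrite /= /disks_diff comp_addl comp_addr -!comp_assoc !biprodE diff_diff.
rewrite !compE add0r addr0.
by rewrite (@transport_diff X _ _ _ _ _ ij).
Qed.

Definition to_disks X : chain_map X (disks X) :=
  @ChainMap _ X (disks X) _ (@to_disks_comm X).

Lemma from_disks_comm X (i j : int) (ij : i = j + 1) :
  (diff_in X j ∘ pr1 + transport X (subrK 1 j) ∘ pr2) ∘
    cc_diff (disks (fun n => X (n + 1))) ij =
  cc_diff X ij ∘ (diff_in X i ∘ pr1 + transport X (subrK 1 i) ∘ pr2).
Proof.
(* On [(y, y')] both sides are the differential of [y']; they meet in the differential of [X]
   indexed by [e]. *)
have e : i - 1 + 1 = j + 1 by rewrite subrK.
rewrite /= /disks_diff comp_addl comp_addr -!comp_assoc !biprodE diff_diffK.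
rewrite !compE add0r addr0.
by rewrite (transport_shift _ _ e) !comp_assoc !(@diff_transport X _ _ _ _ _ e).
Qed.

Definition from_disks X : chain_map (disks (fun n => X (n + 1))) X :=
  @ChainMap _ (disks (fun n => X (n + 1))) X _ (@from_disks_comm X).

Lemma cofibration_factorization X Y (f : chain_map X Y) :
  let K := disks X in
  [/\ f = chain_comp (sum_pr1 Y K) (sum_pair f (to_disks X)),
      forall n, is_monic (sum_pair f (to_disks X) n)
    & quasi_iso (sum_pr1 Y K : hom (sum_complex Y K : Ch A) Y)].
Proof.
split.
- by apply: chain_map_ext => n /=; rewrite !(compE, biprodE) addr0.
(* The retraction reads [x] off [(f x, (x, dx))]. *)
- move=> n; apply: (@split_monic _ _ _ _ (pr1 ∘ pr2)).
  by rewrite /= -!comp_assoc !(compE, biprodE) add0r addr0.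
by apply: sum_pr1_quasi_iso; apply: disks_cycles_bound.
Qed.

Lemma fibration_factorization X Y (f : chain_map X Y) :
  let K := disks (fun n => Y (n + 1)) in
  [/\ f = chain_comp (sum_copair f (from_disks Y)) (sum_in1 X K),
      forall n, is_epic (sum_copair f (from_disks Y) n)
    & quasi_iso (sum_in1 X K : hom (X : Ch A) (sum_complex X K))].
Proof.
split.
- apply: chain_map_ext => n /=.
  by rewrite compE -!comp_assoc !(compE, biprodE) addr0.
(* The section sends [y] to [(0, (0, y))]. *)
- move=> n; apply: (@split_epic _ _ _ _
      (in2 ∘ (in2 ∘ transport Y (esym (subrK 1 n))))).
  rewrite /= !comp_addl -!comp_assoc !(compE, biprodE) add0r.
  by rewrite add0r transportK.
by apply: sum_in1_quasi_iso; apply: disks_cycles_bound.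
Qed.

End Factorizations.

(** * The categories of bounded complexes *)

(* The categories of the theorem are all of the form [induced_category o], up
   to conversion: [o] is the identity for [Ch A] and [sval] for the others. *)
Definition induced_category (C : category) (T : Type) (o : T -> C) : category :=
  @Category T (fun x y => hom (o x) (o y)) (fun x => idm (o x))
    (fun x y z g f => g ∘ f)
    (fun x y z t h g f => comp_assoc h g f)
    (fun x y f => comp_idl f) (fun x y f => comp_idr f).

Definition induced_class (C : category) (T : Type) (o : T -> C)
    (W : morphism_class C) : morphism_class (induced_category o) :=
  fun x y f => W (o x) (o y) f.

(** A closure property shared by all the boundedness conditions. The margin of one degree
    accommodates the shifts in [disks]. *)
Definition near_closed (A : abelian_category) (P : Ch A -> Prop) : Prop :=
  forall X Y V : Ch A, P X -> P Y ->
  (forall n, (forall m, n - 1 <= m <= n + 1 -> is_zero (X m) /\ is_zero (Y m)) ->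
    is_zero (V n)) -> P V.

Section InducedChainCategory.
Variables (A : abelian_category) (T : Type) (o : T -> Ch A) (P : Ch A -> Prop).
Hypothesis P_o : forall x, P (o x).
Hypothesis o_onto : forall X, P X -> exists x, o x = X.
Hypothesis P_zero : forall X : Ch A, (forall n, is_zero (X n)) -> P X.
Hypothesis P_near : near_closed P.

Let M := induced_category o.
Let W : morphism_class M := induced_class (@quasi_iso A).

Lemma lift_near (x y : T) (V : Ch A) :
  (forall n, (forall m, n - 1 <= m <= n + 1 -> is_zero (o x m) /\ is_zero (o y m)) ->
    is_zero (V n)) -> exists v, o v = V.
Proof. by move=> h; apply: o_onto; apply: P_near (P_o x) (P_o y) h. Qed.

Lemma in_window (n : int) : n - 1 <= n <= n + 1.
Proof. by lia. Qed.

(** The degreewise kernel pair of [f] has support within that of [o x], so it lies in [M]; a monic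
    [f] makes its two projections equal, hence is monic in each degree. *)
Lemma induced_monicP (x y : M) (f : hom x y) :
  is_monic f <-> forall n, is_monic ((f : chain_map (o x) (o y)) n).
Proof.
split=> [f_mono n|f_mono z u v fuv]; last first.
  apply: chain_map_ext => n; apply: f_mono.
  exact: (congr1 (fun h : chain_map (o z) (o y) => h n) fuv).
have [V [b [d pb]]] := pullback_complex_exists (f : chain_map (o x) (o y)) f.
have [|v vV] := @lift_near x x V.
  move=> m h; case: (h m (in_window m)).
  exact: pullback_zero (pb m).
subst V; have bd : b = d.
  by apply: (f_mono v); apply: (pullback_chain pb).1.
move=> Z u w fuw; have [t [[<- <-] _]] := (pb n).2 _ _ _ fuw.
by rewrite bd.
Qed.

(** The dual argument, with the cokernel pair. *)
Lemma induced_epicP (x y : M) (f : hom x y) :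
  is_epic f <-> forall n, is_epic ((f : chain_map (o x) (o y)) n).
Proof.
split=> [f_epi n|f_epi z u v fuv]; last first.
  apply: chain_map_ext => n; apply: f_epi.
  exact: (congr1 (fun h : chain_map (o x) (o z) => h n) fuv).
have [V [b [d poP]]] := pushout_complex_exists (f : chain_map (o x) (o y)) f.
have po m : is_pushout ((f : chain_map (o x) (o y)) m)
    ((f : chain_map (o x) (o y)) m) (b m) (d m) by case: (poP m).
have [|v vV] := @lift_near y y V.
  move=> m h; case: (h m (in_window m)).
  exact: pushout_zero (po m).
subst V; have bd : b = d.
  by apply: (f_epi v); apply: (pushout_chain po).1.
move=> Z u w fuw; have [t [[<- <-] _]] := (po n).2 _ _ _ fuw.
by rewrite bd.
Qed.

Lemma induced_pointed : pointed M.
Proof.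
have [O [[Oi Ot] On]] := zero_complex_exists (A := A).
have [x xO] := o_onto (P_zero On); subst O.
by exists x; split=> y; [apply: Oi|apply: Ot].
Qed.

Lemma induced_precofibration : is_precofibration_category W (@is_monic M).
Proof.
apply: monic_precofibration => //.
- exact: induced_pointed.
- by move=> x y f; apply: is_iso_quasi_iso.
- by move=> x y z g f; apply: quasi_iso_2of3.
- move=> x y z i f /induced_monicP i_mono.
  have [V [b [d poP]]] := pushout_complex_exists
    (i : chain_map (o x) (o y)) (f : chain_map (o x) (o z)).
  have po m : is_pushout ((i : chain_map (o x) (o y)) m)
    ((f : chain_map (o x) (o z)) m) (b m) (d m) by case: (poP m).
  have [|v vV] := @lift_near y z V.
    move=> m h; case: (h m (in_window m)).
    exact: pushout_zero (po m).
  subst V; exists v, b, d.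
  have ex m := let: And3 _ _ h := poP m in h (i_mono m).
  have [bi UP] := pushout_chain po; split.
  + by split=> // w; apply: UP.
  + by apply/induced_monicP => m; apply: pushout_exact_monic (ex m) (i_mono m).
  + apply: (@pushout_quasi_iso _ _ _ _ _ i f b d) => // m.
      exact: (po m).1.
    by case: (poP m).
move=> x y f.
have [fE f'm rq] := cofibration_factorization (f : chain_map (o x) (o y)).
have [|v vV] := @lift_near x y (sum_complex (o y) (disks (o x))).
  move=> m h /=.
  apply: biprod_zero; first by case: (h m (in_window m)).
  apply: biprod_zero; first by case: (h m (in_window m)).
  (* In degree [m], [disks (o x)] also contains [o x (m - 1)]. *)
  by case: (h (m - 1)) => //; lia.
(* Abstracting both maps allows the middle complex to be rewritten as [o v] in their types. *)
move: fE f'm rq; move: (sum_pr1 _ _) (sum_pair _ _); rewrite -vV.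
move=> r f' fE f'm rq; exists v, r, f'; split=> //.
exact/induced_monicP.
Qed.

Lemma induced_prefibration : is_prefibration_category W (@is_epic M).
Proof.
apply: (@monic_precofibration (op M)).
- by have [x [xi xt]] := induced_pointed; exists x.
- move=> x y f [g [gf fg]]; apply: is_iso_quasi_iso.
  by exists g.
- move=> x y z g f.
  have [h1 h2 h3] := quasi_iso_2of3 (f : hom (o y) (o x)) (g : hom (o z) (o y)).
  (* Reversing arrows exchanges inner and outer maps, so the two cancellation clauses trade
     places. *)
  by split=> ? ?; [apply: h1|apply: h3|apply: h2].
- move=> x y z p f /induced_epicP p_epi.
  have [V [b [d pb]]] := pullback_complex_exists
    (p : chain_map (o y) (o x)) (f : chain_map (o z) (o x)).
  have [|v vV] := @lift_near y z V.
    move=> m h; case: (h m (in_window m)).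
    exact: pullback_zero (pb m).
  subst V; exists v, b, d.
  have [bi UP] := pullback_chain pb; split.
  + by split=> // w; apply: UP.
  + by apply/induced_epicP => m; apply: pullback_epic (pb m) (p_epi m).
  + exact: (@pullback_quasi_iso _ _ _ _ _ p f b d).
move=> y x f.
have [fE f'm rq] := fibration_factorization (f : chain_map (o x) (o y)).
have [|v vV] := @lift_near x y (sum_complex (o x) (disks (fun n => o y (n + 1)))).
  move=> m h /=.
  apply: biprod_zero; first by case: (h m (in_window m)).
  (* In degree [m] the shifted disks consist of [o y (m + 1)] and [o y (m - 1 + 1)]. *)
  apply: biprod_zero; first by case: (h (m + 1)) => //; lia.
  by rewrite subrK; case: (h m (in_window m)).
move: fE f'm rq; move: (sum_in1 _ _) (sum_copair _ _); rewrite -vV.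
move=> r f' fE f'm rq; exists v, r, f'; split=> //.
exact/induced_epicP.
Qed.

Lemma induced_pointed_ABC_premodel :
  [/\ pointed M, is_ABC_premodel_category W (@is_monic M) (@is_epic M),
      forall x : M, cofibrant (@is_monic M) x
    & forall x : M, fibrant (@is_epic M) x].
Proof.
have M0 := induced_pointed.
have Mop0 : pointed (op M) by case: M0 => x [xi xt]; exists x.
split=> //.
- by split; [apply: induced_precofibration|apply: induced_prefibration].
- by move=> x z i; apply: initial_monic.
- by move=> x z p; apply: (@initial_monic (op M)).
Qed.

End InducedChainCategory.

Section Bounds.
Context {A : abelian_category}.

Lemma bounded_below_near : near_closed (@bounded_below A).
Proof.
(* For [n] below this bound, even [n + 1] is below [N1] and [N2]. *)
move=> X Y V [N1 X0] [N2 Y0] V0; exists (Num.min N1 N2 - 1) => n nN.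
by apply: V0 => m nm; split; [apply: X0|apply: Y0]; lia.
Qed.

Lemma bounded_above_near : near_closed (@bounded_above A).
Proof.
move=> X Y V [N1 X0] [N2 Y0] V0; exists (Num.max N1 N2 + 1) => n nN.
by apply: V0 => m nm; split; [apply: X0|apply: Y0]; lia.
Qed.

Lemma bounded_near : near_closed (@bounded A).
Proof.
move=> X Y V [Xb Xa] [Yb Ya] V0; split.
  exact: bounded_below_near Xb Yb V0.
exact: bounded_above_near Xa Ya V0.
Qed.

End Bounds.

Theorem theorem3p2p4 (A : abelian_category) :
  let claim (M : category) (W : morphism_class M) :=
    [/\ pointed M,
        is_ABC_premodel_category W (@is_monic M) (@is_epic M),
        forall X : M, cofibrant (@is_monic M) X
      & forall X : M, fibrant (@is_epic M) X] in
  [/\ claim (Ch A) (@quasi_iso A),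
      claim (Ch_plus A) (restrict_class (@quasi_iso A)),
      claim (Ch_minus A) (restrict_class (@quasi_iso A))
    & claim (Ch_bounded A) (restrict_class (@quasi_iso A))].
Proof.
have sub (P : Ch A -> Prop) : near_closed P ->
    (forall X : Ch A, (forall n, is_zero (X n)) -> P X) ->
    let M := full_subcategory P in
    [/\ pointed M,
        is_ABC_premodel_category (restrict_class (@quasi_iso A) : morphism_class M)
          (@is_monic M) (@is_epic M),
        forall X : M, cofibrant (@is_monic M) X
      & forall X : M, fibrant (@is_epic M) X].
  move=> P_near P_zero; apply: (@induced_pointed_ABC_premodel A {X | P X} sval P) => //.
    by case.
  by move=> X PX; exists (exist _ X PX).
have below0 (X : Ch A) : (forall n, is_zero (X n)) -> bounded_below X by exists 0.
have above0 (X : Ch A) : (forall n, is_zero (X n)) -> bounded_above X by exists 0.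
split.
- apply: (@induced_pointed_ABC_premodel A (Ch A) id (fun=> True)) => //.
  by move=> X _; exists X.
- exact: sub bounded_below_near below0.
- exact: sub bounded_above_near above0.
- by apply: sub bounded_near _ => X X0; split; [apply: below0|apply: above0].
Qed.
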